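(* Let $u$ be a univariate linear functional supported on the unit circle $\mathbb T$, let $L(z)=L_nz^n+\dots+L_{-n}z^{-n}$ ($n\geq1$, $L_nL_{-n}\ne 0$) be a prepared Laurent polynomial with $\sigma(L)\cap\operatorname{supp}u=\varnothing$, and let $\check u$ be the Geronimus transformation of $u$ determined by $L$ and a matrix of masses $\Xi\in\mathbb C^{2n\times2n}$ (see context), the Gram matrices of $u$ and $\check u$ being quasidefinite. Let $l\ge 2n$ and set $$A_k:=\mathcal J^{\overline{L_*}}_{C_{1,k}}-\mathcal J^{L}_{\phi_{1,k}}\,\Xi\,\mathcal L_*,\qquad B_k:=\mathcal J^{\overline L}_{C_{2,k}}-\mathcal J^{L_*}_{\phi_{2,k}}\,\Xi^\dagger\mathcal L,$$ $$R_l(z):=L(z)\Big(\overline{\mathcal J^{\overline L}_{\overline{K^{[l]}_{C,\phi}}}(z)}-\overline{\mathcal J^{L_*}_{\overline{K^{[l]}}}(z)\,\Xi^\dagger\mathcal L}\Big)+\mathcal J^{L}_{\delta L}(z),$$ $$T_l(z):=\overline{L_*(z)}\Big(\mathcal J^{\overline{L_*}}_{K^{[l]}_{\phi,C}}(\bar z)-\mathcal J^L_{K^{[l]}}(\bar z)\,\Xi\,\mathcal L_*\Big)+\overline{\mathcal J^{L_*}_{\delta L_*}(z)}.$$ Then, whenever the involved quasideterminants exist (i.e. the top-left $2n\times2n$ blocks are invertible), $$\check\phi_{1,l}(z)=\Theta_*\begin{bmatrix}A_{l-2n}&\phi_{1,l-2n}(z)\\ \vdots&\vdots\\ A_l&\phi_{1,l}(z)\end{bmatrix}=-\Theta_*\begin{bmatrix}\overline{B_{l-2n}}&\frac{H_{l-2n}}{L_{(-1)^ln}}\\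 \overline{B_{l-2n+1}}&0\\ \vdots&\vdots\\ \overline{B_{l-1}}&0\\ R_l(z)&0\end{bmatrix},$$ $$\check H_l=\Theta_*\begin{bmatrix}A_{l-2n}&\frac{H_{l-2n}}{L_{(-1)^{l+1}n}}\\ A_{l-2n+1}&0\\ \vdots&\vdots\\ A_l&0\end{bmatrix}=\overline{\Theta_*\begin{bmatrix}B_{l-2n}&\frac{\overline{H_{l-2n}}}{\overline{L_{(-1)^ln}}}\\ B_{l-2n+1}&0\\ \vdots&\vdots\\ B_l&0\end{bmatrix}},$$ $$\overline{\check\phi_{2,l}(z)}=-\Theta_*\begin{bmatrix}A_{l-2n}&\frac{H_{l-2n}}{L_{(-1)^{l+1}n}}\\ A_{l-2n+1}&0\\ \vdots&\vdots\\ A_{l-1}&0\\ T_l(z)&0\end{bmatrix}=\overline{\Theta_*\begin{bmatrix}B_{l-2n}&\phi_{2,l-2n}(z)\\ \vdots&\vdots\\ B_l&\phi_{2,l}(z)\end{bmatrix}}.$$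
   Context: Indices start at $0$; $\mathbb C^*=\mathbb C\setminus\{0\}$; $\sigma(L)$ is the zero set of $L$ in $\mathbb C^*$; a bar over a set is the set of complex conjugates. For a rational function $F$: $\overline F(z):=\overline{F(\bar z)}$ and the reciprocal is $F_*(z):=\overline{F}(z^{-1})=\overline{F(\bar z^{-1})}$. CMV sequence: $\chi(z)=[1,z^{-1},z,z^{-2},z^2,\dots]^\top$. $u$ is a (continuous) linear functional supported on $\mathbb T$ (so that $\bar z=z^{-1}$ inside the pairing), acting on rational functions with nonzero poles outside $\operatorname{supp}u$, with differentiation under the pairing with respect to pole parameters allowed; $\langle f,g\rangle_u=\langle u_z,f(z)\overline{g(z)}\rangle=\langle u_z,f(z)g_*(z)\rangle$. The Gram matrix of a sesquilinear form has entries $\langle\chi^{(k)},\chi^{(l)}\rangle$; it is quasidefinite if all leading principal minors are nonzero, and then $G=S_1^{-1}H(S_2^{-1})^\dagger$ uniquely with $S_a$ lower unitriangular and $H=\operatorname{diag}(H_0,H_1,\dots)$; $\phi_a=S_a\chi=[\phi_{a,0},\phi_{a,1},\dots]^\top$. Further $K^{[l]}(\bar z_1,z_2)=\sum_{k=0}^{l-1}\overline{\phi_{2,k}(z_1)}H_k^{-1}\phi_{1,k}(z_2)$; $C_{1,k}(z)=\langle\phi_{1,k}(w),\frac1{\bar z-w}\rangle_u$ and $\overline{C_{2,k}(z)}=\langle\frac1{\bar z-w},\phi_{2,k}(w)\rangle_u$ for $z\notin\overline{\operatorname{supp}u}$ ($w$ the variable of the pairing); $K^{[l]}_{C,\phi}(\bar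 z_1,z_2)=\sum_{k=0}^{l-1}\overline{C_{2,k}(z_1)}H_k^{-1}\phi_{1,k}(z_2)$, $K^{[l]}_{\phi,C}(\bar z_1,z_2)=\sum_{k=0}^{l-1}\overline{\phi_{2,k}(z_1)}H_k^{-1}C_{1,k}(z_2)$. Let $\zeta_1,\dots,\zeta_d$ be the zeros of $L$ with multiplicities $m_1,\dots,m_d$, $\sum m_i=2n$. Then $L_*$ has zeros $\bar\zeta_i^{-1}$, $\overline L$ has zeros $\bar\zeta_i$, $\overline{L_*}$ has zeros $\zeta_i^{-1}$, all with multiplicities $m_i$ and taken in this order. $L_{(-1)^ln}$ is $L_n$ for $l$ even and $L_{-n}$ for $l$ odd. The matrix $\Xi=(\Xi_{i,k|j,r})$ has rows indexed by pairs $(i,k)$, $1\le i\le d$, $0\le k\le m_i-1$, and columns by pairs $(j,r)$, $1\le j\le d$, $0\le r\le m_j-1$, in lexicographic order. The Geronimus transformation is the functional $\check u$ with $$\langle f,g\rangle_{\check u}=\Big\langle u_z,\frac{f(z)\overline{g(z)}}{L(z)}\Big\rangle+\sum_{i,j=1}^d\sum_{k=0}^{m_i-1}\sum_{r=0}^{m_j-1}\frac1{k!\,r!}\Xi_{i,k|j,r}\,f^{(k)}(\zeta_i)\,\overline{g^{(r)}(\bar\zeta_j^{-1})}.$$ $\check H_k,\check\phi_{1,k},\check\phi_{2,k}$ are the objects associated with $\check u$. Jets: for a Laurent polynomial $M$ with zeros $\eta_1,\dots,\eta_d$ of multiplicities $m_1,\dots,m_d$, $\mathcal J^M_f=[f(\eta_1),f'(\eta_1),\dots,\frac{f^{(m_1-1)}(\eta_1)}{(m_1-1)!},\dots,f(\eta_d),\dots,\frac{f^{(m_d-1)}(\eta_d)}{(m_d-1)!}]\in\mathbb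 C^{2n}$. $\mathcal J^{\overline L}_{\overline{K^{[l]}_{C,\phi}}}(z)$ and $\mathcal J^{L_*}_{\overline{K^{[l]}}}(z)$ are the jets of $x\mapsto\overline{K^{[l]}_{C,\phi}(\bar x,z)}$ and $x\mapsto\overline{K^{[l]}(\bar x,z)}$; $\mathcal J^{\overline{L_*}}_{K^{[l]}_{\phi,C}}(\bar z)$ and $\mathcal J^L_{K^{[l]}}(\bar z)$ are the jets of $x\mapsto K^{[l]}_{\phi,C}(\bar z,x)$ and $x\mapsto K^{[l]}(\bar z,x)$; $\mathcal J^M_{\delta M}(z)$ is the jet of $x\mapsto\delta M(z,x)$, $\delta M(z,x)=\frac{M(z)-M(x)}{z-x}$. For a prepared Laurent polynomial $M(z)=M_nz^{-n}\prod_j(z-\eta_j)^{m_j}$ let $M_{[j]}(z)=M_nz^{-n}\prod_{i\ne j}(z-\eta_i)^{m_i}$, $\ell_{[j],k}=\frac1{k!}\frac{d^k\overline{M_{[j]}}(z)}{dz^k}\big|_{z=\overline{\eta_j}}$, and let the associated matrix be block diagonal with $j$-th block of size $m_j\times m_j$ with $(p,q)$ entry ($0\le p,q\le m_j-1$) equal to $\ell_{[j],\,p+q-m_j+1}$ if $p+q\ge m_j-1$ and $0$ otherwise. $\mathcal L$ is the matrix associated with $M=L$ and $\mathcal L_*$ the one associated with $M=L_*$. Quasideterminant: $\Theta_*\begin{bmatrix}A&B\\C&D\end{bmatrix}=D-CA^{-1}B$ ($A$ square invertible, $B$ column, $C$ row, $D$ scalar). A bar over a vector is entrywise conjugation. 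*)

(* Defs.v *)
Set Warnings "-notation-overridden,-ambiguous-paths,-notation-incompatible-prefix".
From mathcomp Require Export all_boot all_order all_algebra.
From mathcomp Require Export complex.
From mathcomp Require Export all_classical all_reals all_analysis.

Set Implicit Arguments.
Unset Strict Implicit.
Unset Printing Implicit Defensive.

Export Order.TTheory GRing.Theory Num.Theory.
Export numFieldNormedType.Exports.

#[global] Open Scope classical_set_scope.
#[global] Open Scope ring_scope.

(* Everything is stated over a numClosedFieldType K, to be read as the field of
   complex numbers. Rational functions are represented by functions K -> K that
   agree with a quotient of polynomials off a finite set; evaluation,
   conjugation and (complex) derivatives are those of functions. *)

Section RationalFunctions.
Context {K : numClosedFieldType}.

Definition conj_fun (F : K -> K) (z : K) : K := (F z^*)^*.

Definition recip_fun (F : K -> K) (z : K) : K := conj_fun F z^-1.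

(* Since S lies in the unit circle in all uses, a pole at 0 is allowed. *)
Definition rational_off (S : set K) (f : K -> K) : Prop :=
  exists p q : {poly K}, [/\ q != 0,
    (forall s, S s -> q.[s] != 0) &
    finite_set [set z | f z != p.[z] / q.[z]]].

End RationalFunctions.

(* A linear functional supported on the unit circle, acting on the rational
   functions whose nonzero poles lie outside its support. [pairing] is a total
   function; only its values on such rational functions are meaningful.
   [pairing_ext] says that it acts on rational functions, i.e. on their
   representatives up to finite sets, and [pairing_derive] that one may
   differentiate under the pairing with respect to a pole parameter: this is
   the form in which continuity of the functional is used. *)
Record circle_functional (K : numClosedFieldType) := CircleFunctional {
  supp : set K;
  pairing :> (K -> K) -> K;
  supp_closed : closed supp;
  supp_circle : forall z, supp z -> `|z| = 1;
  pairing_ext : forall f g, rational_off supp f -> rational_off supp g ->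
    finite_set [set z | f z != g z] -> pairing f = pairing g;
  pairing_linear : forall (c : K) f g,
    rational_off supp f -> rational_off supp g ->
    pairing (fun w => c * f w + g w) = c * pairing f + pairing g;
  pairing_derive : forall f (b : K) (k : nat),
    rational_off supp f -> b != 0 -> ~ supp b ->
    is_derive b (1 : K)
      (fun x : K => pairing (fun w => f w / (w - x) ^+ k.+1) : K)
      (pairing (fun w => f w * k.+1%:R / (w - b) ^+ k.+2))
}.

Section CMV.
Context {K : numClosedFieldType}.

Definition chi (k : nat) (z : K) : K :=
  if odd k then z ^- uphalf k else z ^+ k./2.

(* On the circle the conjugate of g is its reciprocal, which is what the
   functional, acting on rational functions, is applied to. *)
Definition sform (u : circle_functional K) (f g : K -> K) : K :=
  u (fun z => f z * recip_fun g z).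

Definition gram (B : (K -> K) -> (K -> K) -> K) (k l : nat) : K :=
  B (chi k) (chi l).

(* Semi-infinite matrices are functions nat -> nat -> K. *)
Definition truncmx (N : nat) (A : nat -> nat -> K) : 'M[K]_N :=
  \matrix_(i < N, j < N) A i j.

Definition quasidefinite (B : (K -> K) -> (K -> K) -> K) : Prop :=
  forall N, \det (truncmx N (gram B)) != 0.

Definition lower_unitriangular (S : nat -> nat -> K) : Prop :=
  (forall k, S k k = 1) /\ (forall k l, (k < l)%N -> S k l = 0).

Definition conj_entries {p q} (A : 'M[K]_(p, q)) : 'M[K]_(p, q) :=
  map_mx Num.conj A.

Definition adjmx {p q} (A : 'M[K]_(p, q)) : 'M[K]_(q, p) := (conj_entries A)^T.

Record gauss_data := GaussData {
  gauss_S1 : nat -> nat -> K;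
  gauss_S2 : nat -> nat -> K;
  gauss_H : nat -> K
}.

(* G = S1^-1 H (S2^-1)^dagger, on all leading blocks: since S1 and S2 are lower
   unitriangular, truncation commutes with the inverses and the products. *)
Definition gauss_factorization
    (B : (K -> K) -> (K -> K) -> K) (D : gauss_data) : Prop :=
  [/\ lower_unitriangular (gauss_S1 D), lower_unitriangular (gauss_S2 D) &
      forall N, truncmx N (gram B) =
        invmx (truncmx N (gauss_S1 D))
        *m diag_mx (\row_(i < N) gauss_H D i)
        *m adjmx (invmx (truncmx N (gauss_S2 D)))].

Definition phi1 (D : gauss_data) (k : nat) (z : K) : K :=
  \sum_(j < k.+1) gauss_S1 D k j * chi j z.

Definition phi2 (D : gauss_data) (k : nat) (z : K) : K :=
  \sum_(j < k.+1) gauss_S2 D k j * chi j z.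

Definition cauchy1 (u : circle_functional K) (D : gauss_data) k (z : K) : K :=
  sform u (phi1 D k) (fun w => (z^* - w)^-1).

Definition cauchy2 (u : circle_functional K) (D : gauss_data) k (z : K) : K :=
  (sform u (fun w => (z^* - w)^-1) (phi2 D k))^*.

(* With (F, G) = (phi2, phi1), (C2, phi1), (phi2, C1) these are K^[l],
   K^[l]_(C,phi) and K^[l]_(phi,C) at (conj z1, z2). *)
Definition kernel_sum (D : gauss_data) (F G : nat -> K -> K) (l : nat)
    (z1 z2 : K) : K :=
  \sum_(k < l) (F k z1)^* * (gauss_H D k)^-1 * G k z2.

End CMV.

Arguments gauss_data : clear implicits.

Section Laurent.
Context {K : numClosedFieldType}.

(* z ^ j is the integer power. *)
Definition laurent (n : nat) (a : int -> K) (z : K) : K :=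
  \sum_(j < n.*2.+1) a (j%:Z - n%:Z) * z ^ (j%:Z - n%:Z).

Definition sigma (M : K -> K) : set K := [set z | z != 0 /\ M z = 0].

Definition laurent_zeros (n : nat) (a : int -> K) {d : nat} (m : 'I_d -> nat)
    (zeta : 'I_d -> K) : Prop :=
  [/\ injective zeta, (forall i, zeta i != 0), (forall i, (0 < m i)%N),
      (\sum_i m i = n.*2)%N &
      forall z, z != 0 ->
        laurent n a z = a n%:Z * z ^- n * \prod_(i < d) (z - zeta i) ^+ m i].

(* The value at x = z is that of the divided difference as a Laurent
   polynomial in x and z. *)
Definition divdiff (M : K -> K) (z x : K) : K :=
  if x == z then derive1 M z else (M z - M x) / (z - x).

Context {d : nat} (m : 'I_d -> nat).

(* Pairs (i, k) with k < m i, in lexicographic order, are the block indices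
   of \sum_i m i. *)
Definition jet (eta : 'I_d -> K) (f : K -> K) : 'rV[K]_(\sum_i m i) :=
  \mxrow_(j < d) (\row_(k < m j) (derive1n k f (eta j) / k`!%:R)).

(* lc and eta are the leading coefficient and the zeros of a prepared Laurent
   polynomial of degree n. *)
Definition deflated (n : nat) (lc : K) (eta : 'I_d -> K) (j : 'I_d) (z : K) :=
  lc * z ^- n * \prod_(i < d | i != j) (z - eta i) ^+ m i.

Definition ell n lc eta (j : 'I_d) (k : nat) : K :=
  (k`!%:R)^-1 * derive1n k (conj_fun (deflated n lc eta j)) (eta j)^*.

Definition associated_mx n lc eta : 'M[K]_(\sum_i m i) :=
  \mxdiag_(j < d) (\matrix_(p < m j, q < m j)
    if ((m j).-1 <= p + q)%N then ell n lc eta j (p + q - (m j).-1)%N else 0).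

End Laurent.

Section Geronimus.
Context {K : numClosedFieldType} (u : circle_functional K).
Context (n : nat) (a : int -> K) {d : nat} (m : 'I_d -> nat).
Context (zeta : 'I_d -> K) (Xi : 'M[K]_(\sum_i m i)).

Let L : K -> K := laurent n a.
Let Ls : K -> K := recip_fun L.

Definition zeros_star (i : 'I_d) : K := (zeta i)^*^-1.
Definition zeros_bar (i : 'I_d) : K := (zeta i)^*.
Definition zeros_bar_star (i : 'I_d) : K := (zeta i)^-1.

Definition geronimus (f g : K -> K) : K :=
  u (fun z => f z * recip_fun g z / L z) +
  \sum_(i < d) \sum_(j < d) \sum_(k < m i) \sum_(r < m j)
    (k`!%:R * r`!%:R)^-1 * submxblock Xi i j k r *
    derive1n k f (zeta i) * (derive1n r g (zeros_star j))^*.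

Definition calL : 'M[K]_(\sum_i m i) := associated_mx m n (a n%:Z) zeta.

(* The coefficient of z ^ n in L_* is the conjugate of L_(-n). *)
Definition calL_star : 'M[K]_(\sum_i m i) :=
  associated_mx m n ((a (- n%:Z))^*) zeros_star.

Context (D : gauss_data K).

Definition rowA (k : nat) : 'rV[K]_(\sum_i m i) :=
  jet m zeros_bar_star (cauchy1 u D k)
  - jet m zeta (phi1 D k) *m Xi *m calL_star.

Definition rowB (k : nat) : 'rV[K]_(\sum_i m i) :=
  jet m zeros_bar (cauchy2 u D k)
  - jet m zeros_star (phi2 D k) *m adjmx Xi *m calL.

Definition CDkernel := kernel_sum D (phi2 D) (phi1 D).
Definition CDkernel_Cphi := kernel_sum D (cauchy2 u D) (phi1 D).
Definition CDkernel_phiC := kernel_sum D (phi2 D) (cauchy1 u D).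

Definition rowR (l : nat) (z : K) : 'rV[K]_(\sum_i m i) :=
  L z *: (conj_entries (jet m zeros_bar (fun x => (CDkernel_Cphi l x z)^*))
          - conj_entries (jet m zeros_star (fun x => (CDkernel l x z)^*)
                     *m adjmx Xi *m calL))
  + jet m zeta (divdiff L z).

Definition rowT (l : nat) (z : K) : 'rV[K]_(\sum_i m i) :=
  (Ls z)^* *: (jet m zeros_bar_star (CDkernel_phiC l z)
               - jet m zeta (CDkernel l z) *m Xi *m calL_star)
  + conj_entries (jet m zeros_star (divdiff Ls z)).

End Geronimus.

Definition quasidet {K : numClosedFieldType} {N : nat}
    (A : 'M[K]_N) (B : 'cV[K]_N) (C : 'rV[K]_N) (D : K) : K :=
  D - (C *m invmx A *m B) 0 0.

Definition first_col {K : numClosedFieldType} {N : nat} (c : K) : 'cV[K]_N :=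
  \col_(i < N) if i == 0%N :> nat then c else 0.

(* Main.v *)
Require Import Defs.
From mathcomp Require Import ring lra zify.

Set Implicit Arguments.
Unset Strict Implicit.
Unset Printing Implicit Defensive.

(** Multiplication by [L] in the first slot, or by its reciprocal [Ls = recip_fun L] in the
    second, turns the Geronimus form back into the form of [u]: the weight
    [1 / L] is cancelled and the masses are killed by the zeros of [Ls]
    ([geronimus_star]). Since multiplication by [Ls] raises the CMV degree by
    exactly [2 n], expanding the new orthogonal function [phi1 Dc l] in the old
    ones involves only the last [2 n + 1] of them; the top coefficient is [1]
    and the lowest one is [Lm * gauss_H Dc l / gauss_H D (l - 2 n)]
    ([w_low], [w_l0], [w_l]).

    What determines the remaining coefficients is that the row
      [Af f = (jet of the Cauchy transform of f) - (jet of f) Xi calL_star]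
    depends on [f] only through the numbers [<f, chi_t>] of the Geronimus form
    with [t < 2 n] ([rowA_of_geronimus]). To see this, write
    [Ls(w) - Ls(x) = (w - x) * sum_(t < 2 n) chi_t(w) alpha_t(x)]. Inserting
    this identity in the Cauchy transform of [f] splits it into a combination of
    the conjugates of the [alpha_t] and a multiple of a function vanishing at
    the relevant points to full order, whose jet is zero ([cauchy_split]); on
    the side of the masses, the mixed Taylor coefficients of the divided
    difference at two zeros of [Ls] are the conjugates of the entries of
    [calL_star] ([mixed_jets]).

    Hence [Af (phi1 Dc l) = 0] as soon as [l >= 2 n], by orthogonality. This is
    a linear system with matrix [topA] for the coefficients of [phi1 Dc l], and
    solving it gives the formulas for [phi1 Dc l] and [gauss_H Dc l]. For
    [phi2 Dc l], the same row operation is applied to the difference of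
    [conj (Ls(z))] times the kernel of [u] and the kernel of the transform.
    By the reproducing properties this difference is again a combination of the
    last [2 n] old functions, its lowest coefficient is a multiple of
    [conj (phi2 Dc l z)], and its image is [rowT] because the new kernel
    reproduces the [chi_t] with [t < 2 n], which turns the sum above into the
    divided difference of [Ls] ([rowT_topA]).

    The formulas with [rowB] and [rowR] are those with [rowA] and [rowT] for
    the functional [h |-> conj (u (recip_fun h))], the reciprocal polynomial [Ls], the
    reciprocal zeros and the adjoint matrix of masses: this exchanges the two
    slots of all the forms and the two families of orthogonal functions
    ([geronimus_dual], [rowA_dual], [rowT_dual]). *)

(** * Iterated complex derivatives and Taylor coefficients *)

Section ComplexDifferentiation.
Context {K : numClosedFieldType}.
Implicit Types (U V : set K) (f g : K -> K).

(** [k]-fold complex differentiability on an open set. Recursing on the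
    derivative rather than on the order makes the closure properties below
    one-step inductions. *)
Fixpoint cdiff U (k : nat) f : Prop :=
  if k is k'.+1 then (forall x, U x -> derivable f x 1) /\ cdiff U k' (derive1 f)
  else True.

Definition smooth U f := forall k, cdiff U k f.

Definition tcoef (eta : K) (k : nat) f : K := derive1n k f eta / k`!%:R.

Lemma is_derive1E (f : K -> K) x (df : K) :
  is_derive x (1 : K) f df -> derive1 f x = df.
Proof. by move=> dfx; rewrite derive1E derive_val. Qed.

Lemma eq_on_is_derive U f g x (df : K) : open U -> U x -> {in U, f =1 g} ->
  is_derive x (1 : K) f df -> is_derive x (1 : K) g df.
Proof.
move=> oU Ux fg; apply: near_eq_is_derive.
have : nbhs x U by exact: open_nbhs_nbhs.
by apply: filterS => y Uy; apply: fg; rewrite inE.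
Qed.

Lemma eq_on_derive1 U f g : open U -> {in U, f =1 g} ->
  {in U, derive1 f =1 derive1 g}.
Proof.
move=> oU fg x /set_mem Ux; rewrite !derive1E; apply: near_eq_derive.
have : nbhs x U by exact: open_nbhs_nbhs.
by apply: filterS => y Uy; apply: fg; rewrite inE.
Qed.

Lemma eq_on_derive1n U f g k : open U -> {in U, f =1 g} ->
  {in U, derive1n k f =1 derive1n k g}.
Proof. by move=> oU fg; elim: k => //= k IH; apply: eq_on_derive1. Qed.

Lemma eq_on_cdiff U f g k : open U -> {in U, f =1 g} -> cdiff U k f -> cdiff U k g.
Proof.
move=> oU; elim: k f g => //= k IH f g fg [df df']; split.
  move=> x Ux; move/derivableP: (df x Ux) => /(eq_on_is_derive oU Ux fg).
  by case.
by apply: IH df'; apply: eq_on_derive1.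
Qed.

(** The induction step of the closure lemmas: an explicit derivative on [U] is
    enough, since everything is local on the open set [U]. *)
Lemma cdiff_step U f f' k : open U ->
  (forall x, U x -> is_derive x (1 : K) f (f' x)) -> cdiff U k f' ->
  cdiff U k.+1 f.
Proof.
move=> oU df cf'; split; first by move=> x /df [].
by apply: eq_on_cdiff cf' => // x /set_mem /df /is_derive1E ->.
Qed.

Lemma cdiff_is_derive U f k x : cdiff U k.+1 f -> U x ->
  is_derive x (1 : K) f (derive1 f x).
Proof. by move=> [df _] /df /derivableP; rewrite derive1E. Qed.

Lemma cdiffW U f k : cdiff U k.+1 f -> cdiff U k f.
Proof.
elim: k f => [//|k IH] f [df [df' cf]]; split => //.
by apply: IH; split.
Qed.

Lemma cdiff_sub U V f k : V `<=` U -> cdiff U k f -> cdiff V k f.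
Proof.
move=> VU; elim: k f => //= k IH f [df cf]; split; last exact: IH.
by move=> x /VU; apply: df.
Qed.

Lemma cdiff_cst U k c : open U -> cdiff U k (fun=> c).
Proof.
move=> oU; elim: k c => // k IH c.
by apply: cdiff_step (IH 0) => // x _; exact: is_derive_cst.
Qed.

Lemma cdiff_id U k : open U -> cdiff U k (fun x => x).
Proof.
move=> oU; case: k => // k; apply: cdiff_step (cdiff_cst k 1 oU) => // x _.
Qed.

Lemma cdiffD U k f g : open U -> cdiff U k f -> cdiff U k g ->
  cdiff U k (fun x => f x + g x).
Proof.
move=> oU; elim: k f g => // k IH f g cf cg.
apply: cdiff_step (IH _ _ cf.2 cg.2) => // x Ux.
by apply: is_deriveD; [exact: (cdiff_is_derive cf)|exact: (cdiff_is_derive cg)].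
Qed.

Lemma cdiffM U k f g : open U -> cdiff U k f -> cdiff U k g ->
  cdiff U k (fun x => f x * g x).
Proof.
move=> oU; elim: k f g => // k IH f g cf cg.
apply: (@cdiff_step _ _ (fun x => f x * derive1 g x + g x * derive1 f x)) => //.
  move=> x Ux; apply: is_deriveM;
    [exact: (cdiff_is_derive cf)|exact: (cdiff_is_derive cg)].
apply: cdiffD => //; apply: IH; [exact: cdiffW|exact: cg.2|exact: cdiffW|exact: cf.2].
Qed.

Lemma cdiffV U k f : open U -> (forall x, U x -> f x != 0) ->
  cdiff U k f -> cdiff U k (fun x => (f x)^-1).
Proof.
move=> oU f0; elim: k => // k IH cf.
apply: (@cdiff_step _ _ (fun x => - 1 * ((f x)^-1 * (f x)^-1) * derive1 f x)) => //.
  move=> x Ux; have fx0 := f0 _ Ux.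
  have [df _] := cdiff_is_derive cf Ux.
  have := derivableP (@derivableV K K f x 1 fx0 df); rewrite (@deriveV K K f x 1 fx0 df) -derive1E => h.
  by apply: is_derive_eq h _; rewrite mulN1r -invfM -expr2.
have IHf := IH (cdiffW cf).
apply: cdiffM => //; last by have [] := cf.
by apply: cdiffM => //; [exact: cdiff_cst | exact: cdiffM].
Qed.

Lemma cdiff_inv U k : open U -> ~ U 0 -> cdiff U k (fun x => x^-1).
Proof.
move=> oU U0; apply: cdiffV => //; last exact: cdiff_id.
by move=> x Ux; apply/eqP => x0; rewrite x0 in Ux.
Qed.

Lemma is_derive_comp (f g : K -> K) x (df dg : K) :
  is_derive x (1 : K) f df -> is_derive (f x) (1 : K) g dg ->
  is_derive x (1 : K) (g \o f) (dg * df).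
Proof.
move=> [df1 fE] [dg1 gE].
have /derivable1_diffP dff := df1; have /derivable1_diffP dgg := dg1.
have dgf : differentiable (g \o f) x by exact/differentiable_comp.
apply: DeriveDef; first exact/derivable1_diffP.
have h1 : 'D_1 f x = 'd f x 1 := deriveE _ dff.
have h2 : 'D_1 g (f x) = 'd g (f x) 1 := deriveE _ dgg.
have h3 : 'D_1 (g \o f) x = 'd (g \o f) x 1 := deriveE _ dgf.
rewrite h3.
rewrite diff_comp //=.
have h4 : df = df *: 1 by exact: esym (mulr1 _).
apply: etrans (congr1 ('d g (f x)) (etrans (etrans (esym h1) fE) h4)) _.
apply: etrans (linearZ _ _) _.
apply: etrans (congr1 ( *:%R df) (etrans (esym h2) gE)) _.
exact: mulrC.
Qed.

Lemma cdiff_comp_inv U V k g : open U -> open V -> ~ V 0 ->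
  (forall x, V x -> U x^-1) -> cdiff U k g -> cdiff V k (fun x => g x^-1).
Proof.
move=> oU oV V0 VU; elim: k g => // k IH g cg.
apply: (@cdiff_step _ _ (fun x => derive1 g x^-1 * derive1 (fun x => x^-1) x)) => //.
  move=> x Vx; apply: is_derive_comp.
    exact: (cdiff_is_derive (cdiff_inv 1 oV V0)).
  by apply: (cdiff_is_derive cg); exact: VU.
apply: cdiffM => //; first exact: IH cg.2.
by have [] := cdiff_inv k.+1 oV V0.
Qed.

Lemma cdiff_horner U k (p : {poly K}) : open U -> cdiff U k (fun x => p.[x]).
Proof.
move=> oU; elim/poly_ind: p k => [|p c IH] k.
  apply: (@eq_on_cdiff _ (fun=> 0)) => //; last exact: cdiff_cst.
  by move=> x _; rewrite horner0.
apply: (@eq_on_cdiff _ (fun x => p.[x] * x + c)) => //.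
  by move=> x _; rewrite !hornerE.
apply: cdiffD => //; last exact: cdiff_cst.
by apply: cdiffM => //; exact: cdiff_id.
Qed.

Lemma cdiffX U k f j : open U -> cdiff U k f -> cdiff U k (fun x => f x ^+ j).
Proof.
move=> oU cf; elim: j => [|j IH].
  by apply: (@eq_on_cdiff _ (fun=> 1)) => //; exact: cdiff_cst.
apply: (@eq_on_cdiff _ (fun x => f x * f x ^+ j)) => //.
  by move=> x _; rewrite exprS.
exact: cdiffM.
Qed.

Lemma smooth_is_derive U f k x : smooth U f -> U x ->
  is_derive x (1 : K) (derive1n k f) (derive1n k.+1 f x).
Proof.
move=> sf Ux; suff: cdiff U 1 (derive1n k f) by move/cdiff_is_derive; apply.
elim: k f sf => [|k IH] f sf; first exact: sf.
by rewrite derive1Sn; apply: IH => j; have [] := sf j.+1.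
Qed.

Lemma eq_on_tcoef U f g eta k : open U -> U eta -> {in U, f =1 g} ->
  tcoef eta k f = tcoef eta k g.
Proof.
move=> oU Ue fg; congr (_ / _); apply: (eq_on_derive1n k oU fg); exact: mem_set.
Qed.

Lemma tcoef_lin U f g eta k c : open U -> U eta -> smooth U f -> smooth U g ->
  tcoef eta k (fun x => c * f x + g x) = c * tcoef eta k f + tcoef eta k g.
Proof.
move=> oU Ue sf sg; rewrite /tcoef mulrA -mulrDl; congr (_ / _).
have H : {in U, derive1n k (fun x => c * f x + g x)
      =1 fun x => c * derive1n k f x + derive1n k g x}.
  elim: k => // k IH x Ux; rewrite derive1nS (eq_on_derive1 oU IH Ux).
  move/set_mem: Ux => Ux.
  apply: is_derive1E; apply: is_deriveD; last exact: smooth_is_derive.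
  by apply: is_deriveZ; exact: smooth_is_derive.
by apply: H; exact: mem_set.
Qed.

Lemma smooth_sum U n (c : 'I_n -> K) (f : 'I_n -> K -> K) : open U ->
  (forall i, smooth U (f i)) -> smooth U (fun x => \sum_(i < n) c i * f i x).
Proof.
move=> oU sf k; elim: n c f sf => [|n IH] c f sf.
  apply: (@eq_on_cdiff _ (fun=> 0)) => //; last exact: cdiff_cst.
  by move=> x _; rewrite big_ord0.
apply: (@eq_on_cdiff _ (fun x => \sum_(i < n) c (widen_ord (leqnSn n) i)
    * f (widen_ord (leqnSn n) i) x + c ord_max * f ord_max x)) => //.
  by move=> x _; rewrite big_ord_recr.
apply: cdiffD => //; first by apply: IH => i; exact: sf.
by apply: cdiffM; [|exact: cdiff_cst|exact: sf].
Qed.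

Lemma tcoef_sum U eta k n (c : 'I_n -> K) (f : 'I_n -> K -> K) :
  open U -> U eta -> (forall i, smooth U (f i)) ->
  tcoef eta k (fun x => \sum_(i < n) c i * f i x)
  = \sum_(i < n) c i * tcoef eta k (f i).
Proof.
move=> oU Ue; elim: n c f => [|n IH] c f sf.
  rewrite big_ord0 (_ : (fun _ => _) = cst 0); last first.
    by apply/funext => x; rewrite big_ord0.
  rewrite /tcoef; case: k => [|k]; first by rewrite derive1n0 /cst mul0r.
  suff -> : derive1n k.+1 (cst 0) = cst 0 :> (K -> K) by rewrite /cst mul0r.
  elim: k => [|k IHk]; first by apply/funext => x; rewrite derive1n1 derive1_cst.
  by rewrite derive1nS IHk; apply/funext => x; rewrite derive1_cst.
rewrite big_ord_recl -IH; last by move=> i; exact: sf.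
rewrite -(tcoef_lin _ _ oU Ue) //; last by apply: smooth_sum => // i; exact: sf.
by congr tcoef; apply/funext => x; rewrite big_ord_recl.
Qed.

Lemma derive1n_subM U f (eta : K) k : open U -> smooth U f ->
  {in U, derive1n k (fun x => (x - eta) * f x)
    =1 fun x => (x - eta) * derive1n k f x + derive1n k.-1 f x *+ k}.
Proof.
move=> oU sf; elim: k => [|k IH] x Ux; first by rewrite mulr0n addr0.
rewrite derive1nS (eq_on_derive1 oU IH Ux).
move/set_mem: Ux => Ux; apply: is_derive1E.
have dxe : is_derive x (1 : K) (fun x : K => x - eta) 1.
  by apply: is_derive_shift.
have fk := smooth_is_derive k sf Ux.
have dk : is_derive x (1 : K) (fun y => derive1n k.-1 f y *+ k) (derive1n k f x *+ k).
  case: k {IH fk} => [|k]; first by rewrite mulr0n; exact: is_derive_cst.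
  have := is_deriveZ k.+1%:R (smooth_is_derive k sf Ux).
  rewrite [_ *: _]mulr_natl; congr (is_derive _ _ _ _).
  by apply/funext => y /=; rewrite [LHS]mulr_natl.
apply: is_derive_eq (is_deriveD (is_deriveM dxe fk) dk) _.
by rewrite mulrS /= [_ *: _ in X in _ + X + _]mulr1 addrA.
Qed.

Lemma tcoef_subM0 eta f : tcoef eta 0 (fun x => (x - eta) * f x) = 0.
Proof. by rewrite /tcoef derive1n0 subrr !mul0r. Qed.

(** Together with [tcoef_subM0], this is the only instance of the Leibniz rule
    that is needed: every zero is split off one linear factor at a time. *)
Lemma tcoef_subMS U f (eta : K) k : open U -> U eta -> smooth U f ->
  tcoef eta k.+1 (fun x => (x - eta) * f x) = tcoef eta k f.
Proof.
move=> oU Ue sf; rewrite /tcoef (derive1n_subM _ _ oU sf) ?inE //.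
by rewrite subrr mul0r add0r /= factS natrM -[derive1n _ _ _ *+ _]mulr_natl -mulf_div divff ?mul1r //.
Qed.

Lemma smooth_subM U f (eta : K) : open U -> smooth U f ->
  smooth U (fun x => (x - eta) * f x).
Proof.
move=> oU sf k; apply: cdiffM => //; apply: cdiffD => //; first exact: cdiff_id.
exact: cdiff_cst.
Qed.

(** A zero of order [m] shifts the jet by [m] places; in particular it kills
    a jet of length [m]. *)
Lemma tcoef_expM U f (eta : K) m k : open U -> U eta -> smooth U f ->
  tcoef eta k (fun x => (x - eta) ^+ m * f x)
  = if (k < m)%N then 0 else tcoef eta (k - m) f.
Proof.
move=> oU Ue; elim: m k f => [|m IH] k f sf.
  by rewrite subn0; congr tcoef; apply/funext => x; rewrite expr0 mul1r.
rewrite (_ : (fun _ => _) = fun x => (x - eta) ^+ m * ((x - eta) * f x)); last first.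
  by apply/funext => x; rewrite exprSr mulrA.
rewrite IH; last exact: smooth_subM.
case: (ltngtP k m) => [km|km|->].
- by have -> : (k < m.+1)%N by lia.
- have -> : (k < m.+1)%N = false by lia.
  have -> : (k - m = (k - m.+1).+1)%N by lia.
  exact: (tcoef_subMS _ oU Ue sf).
- by rewrite subnn ltnSn tcoef_subM0.
Qed.

Lemma conj_continuous : continuous (Num.conj : K -> K).
Proof.
move=> x A /nbhs_ballP [e /= e0 H]; apply/nbhs_ballP; exists e => //= y.
by rewrite /ball /= => xy; apply: H; rewrite /ball /= -rmorphB norm_conjC.
Qed.

Lemma conj_dnbhs0 : (Num.conj : K -> K) @ (0 : K)^' --> (0 : K)^'.
Proof.
move=> A [e /= e0 H]; exists e => //= y ye y0; apply: H => /=.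
  by rewrite sub0r normrN norm_conjC; move: ye; rewrite /= sub0r normrN.
by rewrite conjC_eq0.
Qed.

(** Conjugating both the argument and the value leaves the difference quotient
    holomorphic: the two conjugations are isometries and commute with it. *)
Lemma is_derive_conj_fun (f : K -> K) (x df : K) :
  is_derive x^* (1 : K) f df -> is_derive x (1 : K) (conj_fun f) df^*.
Proof.
move=> [fd fE].
have H : h^-1 *: (conj_fun f (h *: 1 + x) - conj_fun f x) @[h --> (0 : K)^'] --> df^*.
  have E : (fun h => h^-1 *: (conj_fun f (h *: 1 + x) - conj_fun f x))
   = Num.conj \o ((fun h => h^-1 *: (f (h *: 1 + x^*) - f x^*)) \o Num.conj).
    apply/funext => h /=; rewrite /conj_fun [h%:A]mulr1 [h^*%:A]mulr1.
    rewrite [RHS]rmorphM fmorphV /=.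
    by rewrite conjCK !rmorphB rmorphD.
  rewrite E; apply: cvg_comp; last exact: conj_continuous.
  apply: cvg_comp; first exact: conj_dnbhs0.
  by rewrite -fE; exact: fd.
apply: DeriveDef; first by apply/cvg_ex; exists (df^*).
exact: cvg_lim.
Qed.

Lemma open_conj U : open U -> open [set x | U x^*].
Proof. by move=> oU; apply: (open_comp _ oU) => x _; exact: conj_continuous. Qed.

Lemma derive1n_conj U f k x : open U -> smooth U f -> U x^* ->
  derive1n k (conj_fun f) x = (derive1n k f x^*)^*.
Proof.
move=> oU sf Ux; have oV := open_conj oU.
suff H : {in [set x | U x^*], derive1n k (conj_fun f) =1 conj_fun (derive1n k f)}.
  by apply: H; exact: mem_set.
elim: k {x Ux} => // k IH x Ux; rewrite derive1nS (eq_on_derive1 oV IH Ux).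
by apply: is_derive1E; apply: is_derive_conj_fun; apply: smooth_is_derive => //; exact: set_mem Ux.
Qed.

Lemma tcoef_conj U f eta k : open U -> smooth U f -> U eta^* ->
  tcoef eta k (conj_fun f) = (tcoef eta^* k f)^*.
Proof.
by move=> oU sf Ue; rewrite /tcoef (derive1n_conj _ oU) // rmorphM fmorphV rmorph_nat.
Qed.

Lemma is_derive_inv (x : K) : x != 0 ->
  is_derive x (1 : K) (fun y : K => y^-1) (- x^-1 ^+ 2).
Proof.
move=> x0; have dx := @derivable_id K K x 1.
have := derivableP (@derivableV K K (fun y => y) x 1 x0 dx).
rewrite (@deriveV K K (fun y => y) x 1 x0 dx) derive_id => h.
by apply: is_derive_eq h _; rewrite [LHS]mulr1 exprVn.
Qed.

Lemma is_derive_exp (x : K) k :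
  is_derive x (1 : K) (fun y : K => y ^+ k) (k%:R * x ^+ k.-1).
Proof.
have := derivableP (@exprn_derivable K k x 1); rewrite exp_derive => h.
by apply: is_derive_eq h _; rewrite [LHS]mulr1.
Qed.

End ComplexDifferentiation.

(** * Rational functions up to finite sets *)

Section RationalFunctionsTheory.
Context {K : numClosedFieldType}.
Implicit Types (f g : K -> K) (p q r : {poly K}) (S : set K).

Definition eq_cofin f g := finite_set [set z | f z != g z].

Lemma eq_cofin_sym f g : eq_cofin f g -> eq_cofin g f.
Proof. by apply: sub_finite_set => z /=; rewrite eq_sym. Qed.

Lemma eq_cofin_trans g f h : eq_cofin f g -> eq_cofin g h -> eq_cofin f h.
Proof.
move=> fg gh; have : finite_set ([set z | f z != g z] `|` [set z | g z != h z]).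
  by rewrite finite_setU.
apply: sub_finite_set => z /= fh; case: (eqVneq (f z) (g z)) => [fgz|]; last by left.
by right; rewrite -fgz.
Qed.

Lemma eq_cofin_map2 (op : K -> K -> K) f g f' g' : eq_cofin f f' -> eq_cofin g g' ->
  eq_cofin (fun z => op (f z) (g z)) (fun z => op (f' z) (g' z)).
Proof.
move=> ff gg; have : finite_set ([set z | f z != f' z] `|` [set z | g z != g' z]).
  by rewrite finite_setU.
apply: sub_finite_set => z /= H.
case: (eqVneq (f z) (f' z)) => [fz|]; last by left.
case: (eqVneq (g z) (g' z)) => [gz|]; last by right.
by rewrite fz gz eqxx in H.
Qed.

Lemma recipK f : recip_fun (recip_fun f) = f.
Proof.
by apply/funext => z; rewrite /recip_fun /conj_fun !conjCK fmorphV /= conjCK invrK.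
Qed.

Lemma recipM f g : recip_fun (fun z => f z * g z) = fun z => recip_fun f z * recip_fun g z.
Proof. by apply/funext => z; rewrite /recip_fun /conj_fun rmorphM. Qed.

Lemma recip_lin c f g : recip_fun (fun z => c * f z + g z)
  = fun z => c^* * recip_fun f z + recip_fun g z.
Proof. by apply/funext => z; rewrite /recip_fun /conj_fun rmorphD rmorphM. Qed.

Lemma eq_off0_recip f g : (forall z, z != 0 -> f z = g z) ->
  forall z, z != 0 -> recip_fun f z = recip_fun g z.
Proof.
by move=> fg z z0; rewrite /recip_fun /conj_fun fg // conjC_eq0 invr_eq0.
Qed.

Lemma eq_cofin_recip f g : eq_cofin f g -> eq_cofin (recip_fun f) (recip_fun g).
Proof.
move=> fg; have := finite_image (fun z : K => (z^-1)^*) fg.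
apply: sub_finite_set => z /= H; exists (z^-1)^*.
  by apply: contraNneq H => H; rewrite /recip_fun /conj_fun H.
by rewrite fmorphV /= conjCK invrK.
Qed.

Lemma finite_roots r : r != 0 -> finite_set [set z | r.[z] == 0].
Proof.
move=> r0; have [s rE] := closed_field_poly_normal r.
apply: (@sub_finite_set _ _ [set` s]); last exact: finite_seq.
move=> z /=; rewrite rE hornerZ mulf_eq0 lead_coef_eq0 (negPf r0) /=.
by rewrite -/(root _ _) root_prod_XsubC.
Qed.

Lemma eq_cofin_poly r f g : r != 0 -> (forall z, r.[z] != 0 -> f z = g z) -> eq_cofin f g.
Proof.
move=> r0 fg; apply: sub_finite_set (finite_roots r0) => z /=.
by apply: contra_neqT => rz; exact: fg.
Qed.

Lemma eq_cofin_off0 f g : (forall z, z != 0 -> f z = g z) -> eq_cofin f g.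
Proof.
by move=> H; apply: (@eq_cofin_poly 'X) => [|z]; rewrite ?polyX_eq0 // hornerX; exact: H.
Qed.

Lemma poly_off0_eq0 p : (forall z, z != 0 -> p.[z] = 0) -> p = 0.
Proof.
move=> H; apply/eqP; apply: contraT => p0.
(* The positive integers up to the size of p would be too many roots. *)
have := @max_poly_roots _ p [seq n%:R | n <- iota 1 (size p)] p0.
rewrite size_map size_iota ltnn; apply.
  apply/allP => x /mapP[n]; rewrite mem_iota => /andP[n0 _] ->.
  by rewrite /root H // pnatr_eq0 -lt0n.
by rewrite map_inj_uniq ?iota_uniq // => i j /eqP; rewrite eqr_nat => /eqP.
Qed.

Section Closure.
Variable S : set K.
Hypothesis Scirc : forall z, S z -> `|z| = 1.

Local Notation rat := (rational_off S).

Lemma rat_ext f g : eq_cofin f g -> rat f -> rat g.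
Proof.
move=> fg [p [q [q0 qS H]]]; exists p, q; split => //.
exact: eq_cofin_trans (eq_cofin_sym fg) H.
Qed.

Lemma rat_div p q : q != 0 -> (forall s, S s -> q.[s] != 0) ->
  rat (fun z => p.[z] / q.[z]).
Proof.
move=> q0 qS; exists p, q; split => //.
by apply: sub_finite_set (finite_roots q0) => z /=; rewrite eqxx.
Qed.

Lemma rat_horner p : rat (fun z => p.[z]).
Proof.
apply: rat_ext (rat_div p (oner_neq0 _) _); last first.
  by move=> s _; rewrite hornerC oner_neq0.
by apply: eq_cofin_off0 => z _; rewrite hornerC divr1.
Qed.

Lemma rat_cst c : rat (fun=> c).
Proof. by apply: rat_ext (rat_horner c%:P); apply: eq_cofin_off0 => z _; rewrite hornerC. Qed.

Lemma rat_inv q : q != 0 -> (forall s, S s -> q.[s] != 0) ->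
  rat (fun z => q.[z]^-1).
Proof.
move=> q0 qS; apply: rat_ext (rat_div 1 q0 qS).
by apply: eq_cofin_off0 => z _; rewrite hornerC mul1r.
Qed.

Lemma ratM f g : rat f -> rat g -> rat (fun z => f z * g z).
Proof.
move=> [p [q [q0 qS H]]] [p' [q' [q0' qS' H']]].
apply: rat_ext (eq_cofin_sym (eq_cofin_map2 *%R H H')) _.
apply: rat_ext (rat_div (p * p') (_ : q * q' != 0) _).
- by apply: eq_cofin_off0 => z _; rewrite !hornerM mulf_div.
- by rewrite mulf_neq0.
- by move=> s Ss; rewrite hornerM mulf_neq0 ?qS ?qS'.
Qed.

Lemma ratD f g : rat f -> rat g -> rat (fun z => f z + g z).
Proof.
move=> [p [q [q0 qS H]]] [p' [q' [q0' qS' H']]].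
apply: rat_ext (eq_cofin_sym (eq_cofin_map2 +%R H H')) _.
apply: rat_ext (rat_div (p * q' + p' * q) (_ : q * q' != 0) _).
- apply: (@eq_cofin_poly (q * q')); first by rewrite mulf_neq0.
  by move=> z; rewrite !hornerE mulf_eq0 negb_or => /andP[a b]; rewrite addf_div.
- by rewrite mulf_neq0.
- by move=> s Ss; rewrite hornerM mulf_neq0 ?qS ?qS'.
Qed.

Lemma ratZ c f : rat f -> rat (fun z => c * f z).
Proof. by move=> rf; apply: ratM rf; exact: rat_cst. Qed.

Lemma rat_sum n (F : 'I_n -> K -> K) : (forall i, rat (F i)) ->
  rat (fun z => \sum_(i < n) F i z).
Proof.
elim: n F => [|n IH] F rF.
  by apply: rat_ext (rat_cst 0); apply: eq_cofin_off0 => z _; rewrite big_ord0.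
apply: rat_ext (ratD (rF ord0) (IH (fun i => F (lift ord0 i)) _)) => [|i]; last exact: rF.
by apply: eq_cofin_off0 => z _; rewrite big_ord_recl.
Qed.

Lemma horner_inv_num p : exists N r, forall z, z != 0 -> p.[z^-1] = r.[z] / z ^+ N.
Proof.
elim/poly_ind: p => [|p c [N [r H]]].
  by exists 0, 0 => z _; rewrite !horner0 mul0r.
exists N.+1, (r + c *: 'X^(N.+1)) => z z0; rewrite !hornerE H // mulrDl mulfK.
  by rewrite exprSr invfM mulrA.
by rewrite expf_neq0.
Qed.

Lemma circle_recip (z : K) : `|z| = 1 -> (z^-1)^* = z.
Proof.
move=> z1; have z0 : z != 0 by rewrite -normr_eq0 z1 oner_eq0.
have zc : z^* != 0 by rewrite conjC_eq0.
by apply: (mulIf zc); rewrite fmorphV /= mulVf // -normCK z1 expr1n.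
Qed.

(** On the circle [(s^-1)^* = s], so the denominator of the reciprocal takes
    there the conjugates of the values of the original one, up to a power. *)
Lemma rat_recip f : rat f -> rat (recip_fun f).
Proof.
move=> [p [q [q0 qS /eq_cofin_recip H]]]; apply: rat_ext (eq_cofin_sym H) _.
have [N [r rE]] := horner_inv_num (map_poly Num.conj p).
have [M [t tE]] := horner_inv_num (map_poly Num.conj q).
have qE z : z != 0 -> t.[z] = z ^+ M * (q.[(z^-1)^*])^*.
  move=> z0; rewrite -horner_map /= conjCK tE // mulrC divfK //.
  by rewrite expf_neq0.
have t0 : t != 0.
  apply: contra_neq q0 => t0; apply: poly_off0_eq0 => z z0.
  have := qE (z^-1)^*; rewrite fmorph_eq0 invr_eq0 => /(_ z0) /esym /eqP.
  rewrite t0 horner0 mulf_eq0 expf_eq0 fmorph_eq0 invr_eq0 (negPf z0) andbF /=.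
  by rewrite fmorphV /= conjCK invrK conjC_eq0 => /eqP.
apply: rat_ext (ratM (rat_horner ('X^M * r)) (rat_inv (_ : 'X^N * t != 0) _)).
- apply: (@eq_cofin_poly ('X * t)).
    by rewrite mulf_neq0 ?polyX_eq0.
  move=> z; rewrite !hornerE mulf_eq0 negb_or => /andP[z0 tz].
  have cE (a : {poly K}) : (a.[(z^-1)^*])^* = (map_poly Num.conj a).[z^-1].
    by rewrite -[in RHS](conjCK z^-1) horner_map.
  have -> : recip_fun (fun z => p.[z] / q.[z]) z
      = (p.[(z^-1)^*])^* / (q.[(z^-1)^*])^*.
    by rewrite /recip_fun /conj_fun rmorphM [X in _ * X]fmorphV.
  rewrite !cE rE // tE //.
  by field; rewrite tz !expf_neq0.
- by rewrite mulf_neq0 // ?polyXn_eq0 // expf_neq0 ?polyX_eq0.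
- move=> s Ss; have s0 : s != 0 by rewrite -normr_eq0 Scirc ?oner_eq0.
  rewrite !hornerE mulf_neq0 ?expf_neq0 // qE // mulf_neq0 ?expf_neq0 //.
  by rewrite conjC_eq0 circle_recip ?Scirc ?qS.
Qed.

End Closure.

End RationalFunctionsTheory.

(** * Laurent polynomials and the CMV filtration *)

Section LaurentPolynomials.
Context {K : numClosedFieldType}.
Implicit Types (f g : K -> K) (p q r : {poly K}).

(** Values at [0] are ignored: because [0^-1 = 0], the rules for multiplying
    the functions [chi k] hold off [0] only. *)
Definition lpoly f := exists N p, forall z, z != 0 -> f z = p.[z] / z ^+ N.

Lemma lpoly_ext f g : (forall z, z != 0 -> f z = g z) -> lpoly f -> lpoly g.
Proof. by move=> fg [N [p H]]; exists N, p => z z0; rewrite -fg // H. Qed.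

Lemma lpoly_cst c : lpoly (fun=> c).
Proof. by exists 0, c%:P => z z0; rewrite hornerC divr1. Qed.

Lemma lpoly_id : lpoly (fun z => z).
Proof. by exists 0, 'X => z z0; rewrite hornerX divr1. Qed.

Lemma lpoly_inv : lpoly (fun z => z^-1).
Proof. by exists 1, 1 => z z0; rewrite hornerC mul1r. Qed.

Lemma lpolyM f g : lpoly f -> lpoly g -> lpoly (fun z => f z * g z).
Proof.
move=> [N [p Hf]] [M [q Hg]]; exists (N + M)%N, (p * q) => z z0.
by rewrite Hf // Hg // hornerM exprD mulf_div.
Qed.

Lemma lpolyD f g : lpoly f -> lpoly g -> lpoly (fun z => f z + g z).
Proof.
move=> [N [p Hf]] [M [q Hg]].
exists (N + M)%N, (p * 'X^M + q * 'X^N) => z z0.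
by rewrite Hf // Hg // !hornerE exprD addf_div ?expf_neq0.
Qed.

Lemma lpolyX f k : lpoly f -> lpoly (fun z => f z ^+ k).
Proof.
move=> lf; elim: k => [|k IH].
  by apply: lpoly_ext (lpoly_cst 1) => z _; rewrite expr0.
by apply: lpoly_ext (lpolyM lf IH) => z _; rewrite exprS.
Qed.

Lemma lpolyZ c f : lpoly f -> lpoly (fun z => c * f z).
Proof. by move=> lf; apply: lpolyM lf; exact: lpoly_cst. Qed.

Lemma lpoly_sum n (F : 'I_n -> K -> K) : (forall i, lpoly (F i)) ->
  lpoly (fun z => \sum_(i < n) F i z).
Proof.
elim: n F => [|n IH] F rF.
  by apply: lpoly_ext (lpoly_cst 0) => z _; rewrite big_ord0.
apply: lpoly_ext (lpolyD (rF ord0) (IH (fun i => F (lift ord0 i)) _)) => [z _|i] //.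
by rewrite big_ord_recl.
Qed.

Lemma lpoly_prod (I : finType) (P : pred I) (F : I -> K -> K) :
  (forall i, lpoly (F i)) -> lpoly (fun z => \prod_(i | P i) F i z).
Proof.
move=> lF; rewrite /index_enum; elim: (Finite.enum I) => [|i s IH].
  by apply: lpoly_ext (lpoly_cst 1) => z _; rewrite big_nil.
case Pi: (P i).
  by apply: lpoly_ext (lpolyM (lF i) IH) => z _; rewrite big_cons Pi.
by apply: lpoly_ext IH => z _; rewrite big_cons Pi.
Qed.

Lemma lpoly_comp_inv f : lpoly f -> lpoly (fun z => f z^-1).
Proof.
move=> [N [p H]]; have [M [r E]] := horner_inv_num p.
exists M, (r * 'X^N) => z z0.
by rewrite H ?invr_eq0 // E // exprVn invrK !hornerE mulrAC.
Qed.

Lemma lpoly_conj f : lpoly f -> lpoly (conj_fun f).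
Proof.
move=> [N [p H]]; exists N, (map_poly Num.conj p) => z z0.
rewrite /conj_fun H ?conjC_eq0 // rmorphM [X in _ * X]fmorphV rmorphXn /= conjCK.
by congr (_ / _); rewrite -[in RHS](conjCK z) horner_map.
Qed.

Lemma lpoly_recip f : lpoly f -> lpoly (recip_fun f).
Proof. by move=> lf; apply: lpoly_comp_inv; exact: lpoly_conj. Qed.

Lemma lpoly_chi k : lpoly (chi k).
Proof.
rewrite /chi; case: (odd k).
  by apply: lpoly_ext (lpolyX (uphalf k) lpoly_inv) => z _; rewrite exprVn.
exact: lpolyX lpoly_id.
Qed.

Definition punctured : set K := [set z | z != 0].

Lemma open_punctured : open punctured.
Proof.
move=> z /= z0; apply/nbhs_ballP; exists `|z|; rewrite /= ?normr_gt0 //.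
move=> y; rewrite /ball /= => H; apply: contraTneq H => ->.
by rewrite subr0 ltxx.
Qed.

Lemma smooth_lpoly U f : open U -> U `<=` punctured -> lpoly f -> smooth U f.
Proof.
move=> oU UP [N [p H]] k.
apply: (@eq_on_cdiff _ _ (fun z => p.[z] * z^-1 ^+ N)) => //.
  by move=> z /set_mem/UP z0; rewrite H // exprVn.
apply: cdiffM => //; first exact: cdiff_horner.
by apply: cdiffX => //; apply: cdiff_inv => // /UP; rewrite /punctured /= eqxx.
Qed.

Lemma rat_lpoly S f : (forall z, S z -> `|z| = 1) -> lpoly f -> rational_off S f.
Proof.
move=> Sc [N [p H]].
apply: rat_ext (ratM (rat_horner S p) (rat_inv (_ : 'X^N != 0) _)).
- by apply: eq_cofin_off0 => z z0; rewrite H // hornerXn.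
- by rewrite expf_neq0 ?polyX_eq0.
- by move=> s /Sc s1; rewrite hornerXn expf_neq0 // -normr_eq0 s1 oner_eq0.
Qed.

(** The span of [chi 0, ..., chi (N - 1)]: the exponents that occur there are
    the [N] consecutive integers starting at [- N./2]. With a polynomial
    numerator the products of such functions need no bookkeeping. *)
Definition cmv_span (N : nat) f : Prop :=
  exists2 p : {poly K}, (size p <= N)%N & forall z, z != 0 -> f z = p.[z] / z ^+ N./2.

Lemma cmv_span_ext N f g : (forall z, z != 0 -> f z = g z) ->
  cmv_span N f -> cmv_span N g.
Proof. by move=> fg [p sp H]; exists p => // z z0; rewrite -fg // H. Qed.

Lemma cmv_span_lpoly N f : cmv_span N f -> lpoly f.
Proof. by move=> [p _ H]; exists N./2, p. Qed.

Lemma half_succ N : N.+1./2 = (odd N + N./2)%N.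
Proof. by rewrite -uphalfE uphalf_half. Qed.

Lemma cmv_spanS N f : cmv_span N f -> cmv_span N.+1 f.
Proof.
move=> [p sp H]; case oN: (odd N).
  exists (p * 'X).
    by apply: leq_trans (size_polyMleq _ _) _; rewrite size_polyX addn2.
  move=> z z0; rewrite H // half_succ oN /= !hornerE.
  by rewrite exprS invfM mulrA [_ / z]mulfK.
by exists p; [exact: ltnW|move=> z z0; rewrite H // half_succ oN].
Qed.

Lemma cmv_spanW N M f : (N <= M)%N -> cmv_span N f -> cmv_span M f.
Proof.
by move=> /subnK <-; elim: (M - N)%N => // k IH /IH; exact: cmv_spanS.
Qed.

Lemma cmv_spanD N f g c : cmv_span N f -> cmv_span N g ->
  cmv_span N (fun z => c * f z + g z).
Proof.
move=> [p sp Hf] [q sq Hg]; exists (c *: p + q).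
  apply: leq_trans (size_polyD _ _) _; rewrite geq_max sq andbT.
  exact: leq_trans (size_scale_leq _ _) sp.
by move=> z z0; rewrite Hf // Hg // hornerD hornerZ mulrDl mulrA.
Qed.

Lemma cmv_span0 f : (forall z, z != 0 -> f z = 0) -> cmv_span 0 f.
Proof. by move=> H; exists 0 => [|z z0]; rewrite ?size_poly0 // H // horner0 mul0r. Qed.

Lemma cmv_span0E f z : cmv_span 0 f -> z != 0 -> f z = 0.
Proof.
by move=> [p]; rewrite leqn0 size_poly_eq0 => /eqP -> H z0; rewrite H // horner0 mul0r.
Qed.

Lemma cmv_span_chi N : cmv_span N.+1 (chi N).
Proof.
case oN: (odd N); last first.
  exists 'X^N; first by rewrite size_polyXn.
  move=> z z0; rewrite /chi oN /= uphalf_half oN hornerXn.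
  apply: (mulIf (expf_neq0 N./2 z0)); rewrite add0n divfK ?expf_neq0 //.
  by rewrite -exprD addnn even_halfK ?oN.
exists 1; first by rewrite size_poly1.
by move=> z z0; rewrite /chi oN /= hornerC mul1r.
Qed.

Lemma cmv_span_sum N (c : nat -> K) : cmv_span N (fun z => \sum_(j < N) c j * chi j z).
Proof.
elim: N => [|N IH]; first by apply: cmv_span0 => z _; rewrite big_ord0.
apply: cmv_span_ext (cmv_spanD (c N) (cmv_span_chi N) (cmv_spanS IH)) => z _.
by rewrite big_ord_recr addrC.
Qed.

Lemma size_le_split p N : (size p <= N.+1)%N ->
  exists2 p' : {poly K}, (size p' <= N)%N & p = p`_N *: 'X^N + p'.
Proof.
move=> sp; exists (\poly_(i < N) p`_i); first exact: size_poly.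
apply/polyP => i; rewrite coefD coefZ coefXn coef_poly.
case: (ltngtP i N) => [iN|iN|->]; rewrite ?mulr0 ?mulr1 ?add0r ?addr0 //.
by rewrite nth_default // (leq_trans sp).
Qed.

Lemma size_le_split0 p N : (size p <= N.+1)%N ->
  exists2 p' : {poly K}, (size p' <= N)%N & p = (p`_0%N)%:P + p' * 'X.
Proof.
move=> sp; exists (\poly_(i < N) p`_i.+1); first exact: size_poly.
apply/polyP => -[|i]; rewrite coefD coefC coefMX coef_poly /= ?addr0 ?add0r //.
by case: ltnP => // iN; rewrite nth_default // (leq_trans sp).
Qed.

(** The top function [chi N] carries the leading coefficient of the numerator
    when [N] is even and its constant coefficient when [N] is odd. *)
Lemma cmv_span_split N f : cmv_span N.+1 f ->
  exists c f0, cmv_span N f0 /\ forall z, z != 0 -> f z = c * chi N z + f0 z.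
Proof.
move=> [p sp H]; case oN: (odd N); last first.
  have [p' sp' pE] := size_le_split sp.
  exists p`_N, (fun z => p'.[z] / z ^+ N./2); split; first by exists p'.
  move=> z z0; rewrite H // {1}pE !hornerE half_succ oN add0n mulrDl; congr (_ + _).
  rewrite -mulrA /chi oN; congr (_ * _).
  apply: (mulIf (expf_neq0 N./2 z0)); rewrite divfK ?expf_neq0 //.
  by rewrite -exprD addnn even_halfK ?oN.
have [p' sp' pE] := size_le_split0 sp.
exists p`_0%N, (fun z => p'.[z] / z ^+ N./2); split; first by exists p'.
move=> z z0; rewrite H // {1}pE !hornerE mulrDl /chi oN; congr (_ + _).
by rewrite half_succ oN exprS invfM mulrA [_ / z]mulfK.
Qed.

Lemma cmv_spanM n q N f : (size q <= n.*2.+1)%N -> cmv_span N f ->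
  cmv_span (N + n.*2) (fun z => q.[z] / z ^+ n * f z).
Proof.
move=> sq [p sp H]; exists (q * p).
  by have := size_polyMleq q p; lia.
move=> z z0; rewrite H // hornerM mulf_div -exprD; congr (_ / _ ^+ _).
by lia.
Qed.

(** The leading coefficient of a product: the exponent of [chi N] is moved
    outwards by [n], to the right for [N] even and to the left for [N] odd. *)
Lemma cmv_chiM n q N : (size q <= n.*2.+1)%N ->
  exists g, cmv_span (N + n.*2) g /\ forall z, z != 0 ->
    q.[z] / z ^+ n * chi N z
    = (if odd N then q`_0%N else q`_n.*2) * chi (N + n.*2) z + g z.
Proof.
move=> sq; case oN: (odd N); last first.
  have [p' sp' pE] := size_le_split sq.
  exists (fun z => ('X^N * p').[z] / z ^+ (N + n.*2)./2); split.
    exists ('X^N * p') => //.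
    by have := size_polyMleq ('X^N) p'; rewrite size_polyXn; lia.
  have [k NE] : exists k, N = k.*2 by exists N./2; rewrite even_halfK ?oN.
  move=> z z0; rewrite {1}pE !hornerE NE -doubleD /chi !odd_double !doubleK.
  rewrite -!muln2 !(exprD, exprM); field.
  by rewrite !expf_neq0.
have [p' sp' pE] := size_le_split0 sq.
exists (fun z => p'.[z] / z ^+ (N + n.*2)./2); split.
  by exists p' => //; lia.
have [k NE] : exists k, N = k.*2.+1.
  by exists N./2; rewrite -[LHS]odd_double_half oN add1n.
move=> z z0; rewrite {1}pE !hornerE /chi oddD oN odd_double /=.
have -> : uphalf N = k.+1 by lia.
have -> : uphalf (N + n.*2) = (k + n).+1 by lia.
have -> : (N + n.*2)./2 = (k + n)%N by lia.
by rewrite !(exprD, exprS); field; rewrite !expf_neq0.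
Qed.

End LaurentPolynomials.

(** * Gauss factorization and biorthogonal functions *)

Section Biorthogonality.
Context {K : numClosedFieldType}.
Implicit Types (f g : K -> K) (D : gauss_data K).

(** What is used of a sesquilinear form on Laurent polynomials, both for the
    form of [u] and for its Geronimus transform. The two extensionality fields
    say that the values at [0] do not matter. *)
Record laurent_form (B : (K -> K) -> (K -> K) -> K) : Prop := LaurentForm {
  form_extl : forall f f' g, lpoly f -> lpoly g ->
    (forall z, z != 0 -> f z = f' z) -> B f g = B f' g;
  form_extr : forall f g g', lpoly f -> lpoly g ->
    (forall z, z != 0 -> g z = g' z) -> B f g = B f g';
  form_linl : forall c f f' g, lpoly f -> lpoly f' -> lpoly g ->
    B (fun z => c * f z + f' z) g = c * B f g + B f' g;
  form_linr : forall c f g g', lpoly f -> lpoly g -> lpoly g' ->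
    B f (fun z => c * g z + g' z) = c^* * B f g + B f g'
}.

Lemma lpoly_phi1 D k : lpoly (phi1 D k).
Proof. by apply: lpoly_sum => i; apply: lpolyZ; exact: lpoly_chi. Qed.

Lemma lpoly_phi2 D k : lpoly (phi2 D k).
Proof. by apply: lpoly_sum => i; apply: lpolyZ; exact: lpoly_chi. Qed.

Lemma lpoly_kernel D l (z : K) : lpoly (kernel_sum D (phi2 D) (phi1 D) l z).
Proof. by apply: lpoly_sum => i; apply: lpolyZ; exact: lpoly_phi1. Qed.

Section Form.
Variables (B : (K -> K) -> (K -> K) -> K).
Hypothesis BP : laurent_form B.

Lemma form0l g : lpoly g -> B (fun=> 0) g = 0.
Proof.
move=> lg; have l0 := @lpoly_cst K 0.
have := form_linl BP 1 l0 l0 lg.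
have E : (fun=> 1 * 0 + 0 : K) = (fun=> 0 : K) :> (K -> K).
  by apply/funext => z; rewrite mulr0 addr0.
rewrite /= E mul1r.
by move/eqP; rewrite -subr_eq0 opprD addrA subrr sub0r oppr_eq0 => /eqP.
Qed.

Lemma form0r f : lpoly f -> B f (fun=> 0) = 0.
Proof.
move=> lf; have l0 := @lpoly_cst K 0.
have := form_linr BP 1 lf l0 l0.
have E : (fun=> 1 * 0 + 0 : K) = (fun=> 0 : K) :> (K -> K).
  by apply/funext => z; rewrite mulr0 addr0.
rewrite /= E rmorph1 mul1r.
by move/eqP; rewrite -subr_eq0 opprD addrA subrr sub0r oppr_eq0 => /eqP.
Qed.

Lemma form_suml n (c : 'I_n -> K) (F : 'I_n -> K -> K) g :
  (forall i, lpoly (F i)) -> lpoly g ->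
  B (fun z => \sum_(i < n) c i * F i z) g = \sum_(i < n) c i * B (F i) g.
Proof.
move=> lF lg; elim: n c F lF => [|n IH] c F lF.
  rewrite big_ord0 -[RHS](form0l lg); congr B.
  by apply/funext => z; rewrite big_ord0.
rewrite big_ord_recl -IH // -form_linl //.
  by congr B; apply/funext => z; rewrite big_ord_recl.
by apply: lpoly_sum => i; apply: lpolyZ.
Qed.

Lemma form_sumr n (c : 'I_n -> K) (F : 'I_n -> K -> K) f :
  (forall i, lpoly (F i)) -> lpoly f ->
  B f (fun z => \sum_(i < n) c i * F i z) = \sum_(i < n) (c i)^* * B f (F i).
Proof.
move=> lF lf; elim: n c F lF => [|n IH] c F lF.
  rewrite big_ord0 -[RHS](form0r lf); congr B.
  by apply/funext => z; rewrite big_ord0.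
rewrite big_ord_recl -IH // -form_linr //.
  by congr B; apply/funext => z; rewrite big_ord_recl.
by apply: lpoly_sum => i; apply: lpolyZ.
Qed.

End Form.

Lemma unitriangular_truncmx (S : nat -> nat -> K) N :
  lower_unitriangular S -> \det (truncmx N S) = 1.
Proof.
move=> [S1 S0]; rewrite det_trig.
  by apply: big1 => i _; rewrite mxE S1.
by apply/is_trig_mxP => i j ij; rewrite mxE S0.
Qed.

Lemma adjmxM p q r (A : 'M[K]_(p, q)) (C : 'M[K]_(q, r)) :
  adjmx (A *m C) = adjmx C *m adjmx A.
Proof. by rewrite /adjmx /conj_entries map_mxM trmx_mul. Qed.

Lemma adjmxK p q (M : 'M[K]_(p, q)) : adjmx (adjmx M) = M.
Proof. by apply/matrixP => i j; rewrite !mxE conjCK. Qed.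

Section Gauss.
Variables (B : (K -> K) -> (K -> K) -> K) (D : gauss_data K).
Hypotheses (BP : laurent_form B) (qB : quasidefinite B)
  (DP : gauss_factorization B D).

Lemma phi_trunc (S : nat -> nat -> K) N k z : lower_unitriangular S -> (k < N)%N ->
  \sum_(j < k.+1) S k j * chi j z = \sum_(j < N) S k j * chi j z.
Proof.
move=> [_ S0] kN; rewrite (big_ord_widen N (fun j => S k j * chi j z)) //.
rewrite big_mkcond; apply: eq_bigr => j _; case: ltnP => // kj.
by rewrite S0 // mul0r.
Qed.

(** The factorization [G = S1^-1 H (S2^-1)^dagger], multiplied by [S1] on the
    left and by the adjoint of [S2] on the right. *)
Lemma biorthogonal k l :
  B (phi1 D k) (phi2 D l) = (k == l)%:R * gauss_H D k.
Proof.
have [L1 L2 GE] := DP; set N := (maxn k l).+1.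
have kN : (k < N)%N by rewrite ltnS leq_maxl.
have l0DN : (l < N)%N by rewrite ltnS leq_maxr.
have -> : phi1 D k = fun z => \sum_(j < N) gauss_S1 D k j * chi j z.
  by apply/funext => z; exact: phi_trunc.
have -> : phi2 D l = fun z => \sum_(j < N) gauss_S2 D l j * chi j z.
  by apply/funext => z; exact: phi_trunc.
rewrite form_suml //; last 2 first.
- by move=> i; exact: lpoly_chi.
- by apply: lpoly_sum => i; apply: lpolyZ; exact: lpoly_chi.
set T1 := truncmx N (gauss_S1 D); set T2 := truncmx N (gauss_S2 D).
have u1 : T1 \in unitmx by rewrite unitmxE unitriangular_truncmx // unitr1.
have u2 : T2 \in unitmx by rewrite unitmxE unitriangular_truncmx // unitr1.
have E : T1 *m truncmx N (gram B) *m adjmx T2 = diag_mx (\row_(i < N) gauss_H D i).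
  rewrite GE !mulmxA mulmxV // mul1mx -mulmxA -adjmxM mulmxV //.
  by rewrite /adjmx /conj_entries map_mx1 trmx1 mulmx1.
have := congr1 (fun A : 'M[K]_N => A (Ordinal kN) (Ordinal l0DN)) E.
rewrite /= !mxE -(inj_eq val_inj) /= mulr_natl => <-.
under [RHS]eq_bigr do rewrite !mxE mulr_suml.
rewrite exchange_big /=; apply: eq_bigr => i _.
rewrite form_sumr //; [|by move=> j; exact: lpoly_chi|exact: lpoly_chi].
rewrite mulr_sumr; apply: eq_bigr => j _; rewrite !mxE /gram /=.
by rewrite -mulrA [_^* * _]mulrC.
Qed.

Lemma gauss_H_neq0 k : gauss_H D k != 0.
Proof.
have [_ _ GE] := DP; have := qB k.+1; rewrite GE !det_mulmx det_diag.
rewrite !mulf_eq0 !negb_or => /andP[/andP[_ H] _]; move: H.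
by rewrite big_ord_recr /= mulf_eq0 negb_or => /andP[_]; rewrite mxE.
Qed.

Lemma phi1_monic k : exists2 f0, cmv_span k f0 &
  forall z, phi1 D k z = chi k z + f0 z.
Proof.
have [[L1 _] _ _] := DP.
exists (fun z => \sum_(j < k) gauss_S1 D k j * chi j z); first exact: cmv_span_sum.
by move=> z; rewrite /phi1 big_ord_recr /= L1 mul1r addrC.
Qed.

Lemma phi2_monic k : exists2 f0, cmv_span k f0 &
  forall z, phi2 D k z = chi k z + f0 z.
Proof.
have [_ [L1 _] _] := DP.
exists (fun z => \sum_(j < k) gauss_S2 D k j * chi j z); first exact: cmv_span_sum.
by move=> z; rewrite /phi2 big_ord_recr /= L1 mul1r addrC.
Qed.

Lemma span_phi1 k : cmv_span k.+1 (phi1 D k).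
Proof. exact: cmv_span_sum. Qed.

Lemma span_phi2 k : cmv_span k.+1 (phi2 D k).
Proof. exact: cmv_span_sum. Qed.

Lemma span_split1 N f : cmv_span N.+1 f -> exists c f0,
  cmv_span N f0 /\ forall z, z != 0 -> f z = c * phi1 D N z + f0 z.
Proof.
move=> /cmv_span_split [c [f0 [sf0 fE]]]; have [g sg gE] := phi1_monic N.
exists c, (fun z => - c * g z + f0 z); split; first exact: cmv_spanD.
by move=> z z0; rewrite fE // gE; ring.
Qed.

Lemma span_split2 N f : cmv_span N.+1 f -> exists c f0,
  cmv_span N f0 /\ forall z, z != 0 -> f z = c * phi2 D N z + f0 z.
Proof.
move=> /cmv_span_split [c [f0 [sf0 fE]]]; have [g sg gE] := phi2_monic N.
exists c, (fun z => - c * g z + f0 z); split; first exact: cmv_spanD.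
by move=> z z0; rewrite fE // gE; ring.
Qed.

Lemma orthogonal_phi1 k N g : cmv_span N g -> (N <= k)%N -> B (phi1 D k) g = 0.
Proof.
elim: N g => [|N IH] g sg Nk.
  rewrite (form_extr (g' := fun=> 0) BP) ?form0r //; try exact: lpoly_phi1.
    exact: cmv_span_lpoly sg.
  by move=> z; exact: cmv_span0E.
have [c [f0 [sf0 fE]]] := span_split2 sg.
rewrite (form_extr BP (lpoly_phi1 _ _) (cmv_span_lpoly sg) fE).
rewrite form_linr ?(IH f0) //; try exact: lpoly_phi1; try exact: lpoly_phi2.
- by rewrite biorthogonal gtn_eqF // mul0r mulr0 add0r.
- exact: ltnW.
- exact: cmv_span_lpoly sf0.
Qed.

Lemma orthogonal_phi2 k N f : cmv_span N f -> (N <= k)%N -> B f (phi2 D k) = 0.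
Proof.
elim: N f => [|N IH] g sg Nk.
  rewrite (form_extl (f' := fun=> 0) BP) ?form0l //; try exact: lpoly_phi2.
    exact: cmv_span_lpoly sg.
  by move=> z; exact: cmv_span0E.
have [c [f0 [sf0 fE]]] := span_split1 sg.
rewrite (form_extl BP (cmv_span_lpoly sg) (lpoly_phi2 _ _) fE).
rewrite form_linl ?(IH f0) //; try exact: lpoly_phi1; try exact: lpoly_phi2.
- by rewrite biorthogonal ltn_eqF // mul0r mulr0 add0r.
- exact: ltnW.
- exact: cmv_span_lpoly sf0.
Qed.

Lemma expand_phi1 N f z : cmv_span N f -> z != 0 ->
  f z = \sum_(k < N) B f (phi2 D k) / gauss_H D k * phi1 D k z.
Proof.
move=> sf z0; elim: N f sf => [|N IH] f sf.
  by rewrite big_ord0; exact: cmv_span0E sf z0.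
have [c [f0 [sf0 fE]]] := span_split1 sf.
have BE g : lpoly g -> B f g = c * B (phi1 D N) g + B f0 g.
  move=> lg; rewrite (form_extl BP (cmv_span_lpoly sf) lg fE) form_linl //.
    exact: lpoly_phi1.
  exact: cmv_span_lpoly sf0.
rewrite fE // big_ord_recr /= [RHS]addrC (IH _ sf0); congr (_ + _).
  rewrite BE; last exact: lpoly_phi2.
  rewrite biorthogonal eqxx mul1r (orthogonal_phi2 sf0) // addr0.
  by rewrite mulfK // gauss_H_neq0.
apply: eq_bigr => k _; rewrite BE; last exact: lpoly_phi2.
by rewrite biorthogonal gtn_eqF // mul0r mulr0 add0r.
Qed.

(** The Christoffel-Darboux kernel represents evaluation at [z] on the span of
    the first [N] functions. *)
Lemma reproducing N g z : cmv_span N g -> z != 0 ->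
  B (kernel_sum D (phi2 D) (phi1 D) N z) g = (g z)^*.
Proof.
move=> sg z0; rewrite /kernel_sum form_suml //; last 2 first.
- by move=> i; exact: lpoly_phi1.
- exact: cmv_span_lpoly sg.
elim: N g sg => [|N IH] g sg.
  by rewrite big_ord0 (cmv_span0E sg z0) conjC0.
have [c [f0 [sf0 fE]]] := span_split2 sg.
have BE f : lpoly f -> B f g = c^* * B f (phi2 D N) + B f f0.
  move=> lf; rewrite (form_extr BP lf (cmv_span_lpoly sg) fE) form_linr //.
    exact: lpoly_phi2.
  exact: cmv_span_lpoly sf0.
rewrite fE // big_ord_recr rmorphD rmorphM /= [LHS]addrC -(IH _ sf0); congr (_ + _).
  rewrite BE; last exact: lpoly_phi1.
  rewrite biorthogonal eqxx mul1r (orthogonal_phi1 sf0) // addr0.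
  by rewrite mulrCA mulfVK ?gauss_H_neq0 // mulrC.
apply: eq_bigr => k _; rewrite BE; last exact: lpoly_phi1.
by rewrite biorthogonal ltn_eqF // mul0r mulr0 add0r.
Qed.

End Gauss.

End Biorthogonality.

(** * Zeros and divided differences of Laurent polynomials *)

Section LaurentZeros.
Context {K : numClosedFieldType}.
Implicit Types (f g : K -> K) (p q r : {poly K}) (a : int -> K).

Lemma laurent_poly n a : exists2 q : {poly K}, (size q <= n.*2.+1)%N &
  (forall z, z != 0 -> laurent n a z = q.[z] / z ^+ n) /\
  (forall i, (i <= n.*2)%N -> q`_i = a (i%:Z - n%:Z)).
Proof.
exists (\poly_(j < n.*2.+1) a (j%:Z - n%:Z)); first exact: size_poly.
split; last by move=> i iN; rewrite coef_poly ltnS iN.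
move=> z z0; rewrite horner_poly /laurent mulr_suml; apply: eq_bigr => j _.
by rewrite -mulrA; congr (_ * _); rewrite expfzDr // -exprnN.
Qed.

Lemma lpoly_laurent n a : lpoly (laurent n a).
Proof. by have [q _ [H _]] := laurent_poly n a; exists n, q. Qed.

(** The coefficients of the reciprocal polynomial [Ls]. *)
Definition star_coef a (j : int) : K := (a (- j))^*.

Lemma recip_laurent n a : recip_fun (laurent n a) = laurent n (star_coef a).
Proof.
apply/funext => z; rewrite /recip_fun /conj_fun /laurent rmorph_sum /=.
rewrite (reindex_inj rev_ord_inj) /=; apply: eq_bigr => j _.
have -> : (n.*2.+1 - j.+1)%:Z - n%:Z = - (j%:Z - n%:Z) by have := ltn_ord j; lia.
rewrite /star_coef rmorphM /=; congr (_ * _).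
by rewrite fmorphXz /= conjCK exprz_inv opprK.
Qed.

Section Zeros.
Variables (n : nat) (a : int -> K) (d : nat) (m : 'I_d -> nat) (zeta : 'I_d -> K).
Hypothesis zetaP : laurent_zeros n a m zeta.

Lemma laurent_poly_prod q : (forall z, z != 0 -> laurent n a z = q.[z] / z ^+ n) ->
  q = a n%:Z *: \prod_(i < d) ('X - (zeta i)%:P) ^+ m i.
Proof.
have [_ _ _ _ LE] := zetaP => H; apply/eqP; rewrite -subr_eq0; apply/eqP.
apply: poly_off0_eq0 => z z0; have zn := expf_neq0 n z0.
rewrite hornerD hornerN hornerZ horner_prod.
have := H z z0; rewrite LE // => /(congr1 (fun x => x * z ^+ n)).
rewrite divfK // => <-; rewrite mulrAC divfK //.
by under [X in _ - _ * X]eq_bigr do rewrite horner_exp hornerXsubC; rewrite subrr.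
Qed.

(** Compare the constant coefficients of [z ^ n * L(z)] and of its
    factorization into linear factors. *)
Lemma laurent_low : a (- n%:Z) = a n%:Z * \prod_(i < d) (- zeta i) ^+ m i.
Proof.
have [q sq [qE qc]] := laurent_poly n a.
have := qc 0%N (leq0n _); rewrite sub0r => <-.
rewrite -horner_coef0 (laurent_poly_prod qE) hornerZ horner_prod.
by congr (_ * _); apply: eq_bigr => i _; rewrite horner_exp hornerXsubC sub0r.
Qed.

(** In [Ls] the leading coefficient is the conjugate of the lowest one of [L];
    [laurent_low] accounts for the factors [- zeta i] produced by inverting the
    linear factors. *)
Lemma laurent_zeros_star : laurent_zeros n (star_coef a) m (zeros_star zeta).
Proof.
have [inj z0 m0 sm LE] := zetaP; split => //.
- by move=> i j /invr_inj /(can_inj (@conjCK K)) /inj.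
- by move=> i; rewrite invr_eq0 conjC_eq0.
move=> z zN0; rewrite -recip_laurent /recip_fun /conj_fun LE; last first.
  by rewrite conjC_eq0 invr_eq0.
rewrite /star_coef laurent_low !rmorphM !rmorph_prod /= -!mulrA; congr (_ * _).
have -> : (((z^-1)^* ^- n))^* = z ^+ n.
  by rewrite [LHS]fmorphV rmorphXn /= conjCK exprVn invrK.
have E : z ^+ n = z ^- n * \prod_(i < d) z ^+ m i.
  rewrite prodrXr sm -addnn exprD mulKf //.
  by rewrite expf_neq0.
rewrite {1}E [RHS]mulrCA -!mulrA -!big_split /=; congr (_ * _); apply: eq_bigr => i _.
have zi0 : (zeta i)^* != 0 by rewrite conjC_eq0.
rewrite !rmorphXn /= -!exprMn; congr (_ ^+ _).
rewrite /zeros_star rmorphB rmorphN /= conjCK; field.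
by rewrite zi0 zN0.
Qed.

Lemma lpoly_deflated lc (eta : 'I_d -> K) j : lpoly (deflated m n lc eta j).
Proof.
have l1 : lpoly (fun z : K => z ^- n).
  by apply: lpoly_ext (lpolyX n (@lpoly_inv K)) => z _; rewrite exprVn.
apply: lpolyM (lpolyZ lc l1) _; apply: lpoly_prod => i; apply: lpolyX.
by apply: lpolyD; [exact: lpoly_id|exact: lpoly_cst].
Qed.

Lemma laurent_factor j z : z != 0 ->
  laurent n a z = (z - zeta j) ^+ m j * deflated m n (a n%:Z) zeta j z.
Proof.
have [_ _ _ _ LE] := zetaP => z0; rewrite LE // (bigD1 j) //= /deflated.
by rewrite mulrCA.
Qed.

Lemma tcoef_laurent j k : tcoef (zeta j) k (laurent n a)
  = if (k < m j)%N then 0 else tcoef (zeta j) (k - m j) (deflated m n (a n%:Z) zeta j).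
Proof.
have [_ z0 _ _ _] := zetaP; have oP := @open_punctured K.
rewrite -(tcoef_expM _ _ oP) //; try exact: z0; last first.
  by apply: smooth_lpoly => //; exact: lpoly_deflated.
by apply: (eq_on_tcoef _ oP); [exact: z0|move=> z /set_mem; exact: laurent_factor].
Qed.

End Zeros.

(** The divided difference of [f] is a polynomial in two variables; it is
    recorded by its expansion in the first variable along the CMV functions,
    the form in which orthogonality can be applied to it. *)
Definition has_divdiff (N : nat) f := exists2 al : nat -> K -> K,
  (forall t, lpoly (al t)) &
  forall w x, w != 0 -> x != 0 ->
    f w - f x = (w - x) * \sum_(t < N) chi t w * al t x.

Lemma has_divdiff_ext N f g : (forall z, z != 0 -> f z = g z) -> has_divdiff N f -> has_divdiff N g.
Proof. by move=> fg [al lal H]; exists al => // w x w0 x0; rewrite -!fg // H. Qed.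

Lemma has_divdiff_lin N c f g : has_divdiff N f -> has_divdiff N g -> has_divdiff N (fun z => c * f z + g z).
Proof.
move=> [al lal H] [be lbe H']; exists (fun t x => c * al t x + be t x).
  by move=> t; apply: lpolyD => //; exact: lpolyZ.
move=> w x w0 x0.
rewrite (_ : _ - _ = c * (f w - f x) + (g w - g x)); last by ring.
rewrite H // H' // mulrCA -mulrDr mulr_sumr -big_split /=; congr (_ * _).
by apply: eq_bigr => t _; ring.
Qed.

Lemma has_divdiff_chi1 N s (be : K -> K) f : (s < N)%N -> lpoly be ->
  (forall w x, w != 0 -> x != 0 -> f w - f x = (w - x) * (chi s w * be x)) ->
  has_divdiff N f.
Proof.
move=> sN lbe H; exists (fun t x => (t == s)%:R * be x).
  by move=> t; apply: lpolyZ.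
move=> w x w0 x0; rewrite H // (bigD1 (Ordinal sN)) //= eqxx mul1r big1 ?addr0 //.
by move=> t ts; rewrite (_ : (_ == _) = false) ?mul0r ?mulr0 //; apply: negbTE.
Qed.

Lemma has_divdiff_step N s (be ga : K -> K) f g : (s < N)%N -> lpoly be -> lpoly ga ->
  has_divdiff N g ->
  (forall w x, w != 0 -> x != 0 ->
     f w - f x = be x * (g w - g x) + (w - x) * (chi s w * ga x)) ->
  has_divdiff N f.
Proof.
move=> sN lbe lga [al lal H] fE.
exists (fun t x => be x * al t x + (t == s)%:R * ga x).
  by move=> t; apply: lpolyD; [exact: lpolyM|exact: lpolyZ].
move=> w x w0 x0; rewrite fE // H // mulrCA -mulrDr; congr (_ * _).
under [RHS]eq_bigr do rewrite mulrDr.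
rewrite big_split /= mulr_sumr; congr (_ + _).
  by apply: eq_bigr => t _; rewrite mulrCA.
rewrite (bigD1 (Ordinal sN)) //= eqxx mul1r big1 ?addr0 //.
by move=> t ts; rewrite (_ : (_ == _) = false) ?mul0r ?mulr0 //; apply: negbTE.
Qed.

Lemma has_divdiff0 N c : has_divdiff N (fun=> c).
Proof.
exists (fun _ _ => 0); first by move=> t; exact: lpoly_cst.
by move=> w x _ _; rewrite subrr big1 ?mulr0 // => i _; rewrite mulr0.
Qed.

(** Positive and negative powers are treated by two inductions: the divided
    difference of [z ^ (k + 1)] needs [w ^ k] beyond that of [z ^ k], whereas
    that of [z ^ - (k + 1)] already contains [w ^ - (k + 1)]. This is why an
    odd index [s] must be strictly less than [N]. *)
Lemma has_divdiff_chi N s : (s < N)%N || (s == N) && ~~ odd N -> has_divdiff N (chi s).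
Proof.
rewrite -[s in has_divdiff _ (chi s)](odd_double_half s) => sN.
have l1 := @lpoly_id K; have l2 := @lpoly_inv K.
case os: (odd s); rewrite ?add0n ?add1n; last first.
  have : (s./2.*2 <= N)%N by lia.
  elim: s./2 => [|k IH] kN.
    by apply: has_divdiff_ext (has_divdiff0 N 1) => z _; rewrite /chi expr0.
  apply: (@has_divdiff_step N k.*2 (fun x => x) (fun=> 1) _ (chi k.*2)) => //; try by lia.
  - exact: lpoly_cst.
  - by apply: IH; lia.
  by move=> w x w0 x0; rewrite /chi !odd_double !doubleK !exprS; ring.
have : (s./2.*2.+1 < N)%N by lia.
have chiE (k : nat) (z : K) : chi k.*2.+1 z = z^-1 ^+ k.+1.
  have ok : odd k.*2.+1 by lia.
  have uk : uphalf k.*2.+1 = k.+1 by lia.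
  rewrite /chi ok uk.
  by rewrite exprVn.
elim: s./2 => [|k IH] kN.
  apply: (@has_divdiff_chi1 N 1 (fun x => - 1 * x^-1)) => //; first exact: lpolyZ.
  by move=> w x w0 x0; rewrite !(chiE 0%N) !expr1; field; rewrite w0 x0.
apply: (@has_divdiff_step N k.*2.+3 (fun x => x^-1) (fun x => - 1 * x^-1) _ (chi k.*2.+1)) => //.
- exact: lpolyZ.
- by apply: IH; lia.
move=> w x w0 x0; rewrite -doubleS !chiE !exprS.
by field; rewrite w0 x0.
Qed.

Lemma has_divdiff_span n f : cmv_span n.*2.+1 f -> has_divdiff n.*2 f.
Proof.
move: (leqnn n.*2.+1); move: {1 3}(n.*2.+1) => N; elim: N f => [|N IH] f Nn sf.
  by apply: has_divdiff_ext (has_divdiff0 _ 0) => z z0; rewrite (cmv_span0E sf z0).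
have [c [f0 [sf0 fE]]] := cmv_span_split sf.
apply: has_divdiff_ext (has_divdiff_lin c (@has_divdiff_chi _ N _) (IH _ _ sf0)).
- by move=> z z0; rewrite fE.
- by rewrite odd_double andbT; lia.
- exact: ltnW.
Qed.

Lemma has_divdiff_laurent n a : has_divdiff n.*2 (laurent n a).
Proof.
have [q sq [H _]] := laurent_poly n a; apply: has_divdiff_span; exists q => // z z0.
by rewrite H //; congr (_ / _ ^+ _); lia.
Qed.

End LaurentZeros.

(** * Mixed Taylor coefficients of a divided difference *)

Section MixedJets.
Context {K : numClosedFieldType}.
Implicit Types (f g : K -> K) (a : int -> K).

Lemma tcoef_cst (eta : K) k c : tcoef eta k (fun=> c) = (k == 0%N)%:R * c.
Proof.
rewrite /tcoef; case: k => [|k]; first by rewrite derive1n0 divr1 mul1r.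
suff -> : derive1n k.+1 (fun=> c) = fun=> 0 :> K by rewrite !mul0r.
elim: k => [|k IH]; first by apply/funext => x; rewrite derive1n1 derive1_cst.
by rewrite derive1nS IH; apply/funext => x; rewrite derive1_cst.
Qed.

Lemma smooth_punctured f : lpoly f -> smooth punctured f.
Proof. by apply: smooth_lpoly => //; exact: open_punctured. Qed.

Lemma jetE d (m : 'I_d -> nat) (eta : 'I_d -> K) f s :
  jet m eta f 0 s = tcoef (eta (tagnat.sig1 s)) (tagnat.sig2 s) f.
Proof. by rewrite !mxE. Qed.

Lemma associated_mxE d (m : 'I_d -> nat) n lc (eta : 'I_d -> K) s t :
  associated_mx m n lc eta s t =
  if tagnat.sig1 s == tagnat.sig1 t then
    if ((m (tagnat.sig1 s)).-1 <= tagnat.sig2 s + tagnat.sig2 t)%N then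
      ell m n lc eta (tagnat.sig1 s)
        (tagnat.sig2 s + tagnat.sig2 t - (m (tagnat.sig1 s)).-1)%N
    else 0 else 0.
Proof.
rewrite !mxE; move: (tagnat.sig2 t); case: eqVneq => [E|_] q; last by rewrite mxE.
by move: q; case: _ / E => q; rewrite conform_mx_id mxE.
Qed.

Lemma ell_tcoef d (m : 'I_d -> nat) n lc (eta : 'I_d -> K) j k : eta j != 0 ->
  ell m n lc eta j k = (tcoef (eta j) k (deflated m n lc eta j))^*.
Proof.
move=> e0; rewrite -[in RHS](conjCK (eta j)) -(tcoef_conj _ open_punctured).
- by rewrite /ell mulrC.
- exact: smooth_punctured (lpoly_deflated _ _ _ _ _).
- by rewrite /punctured /= conjCK.
Qed.

Section Mixed.
Variables (N : nat) (f : K -> K) (al : nat -> K -> K).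
Hypotheses (lf : lpoly f) (lal : forall t, lpoly (al t)).
Hypothesis fE : forall w x, w != 0 -> x != 0 ->
    f w - f x = (w - x) * \sum_(t < N) chi t w * al t x.

(** The [k]-th Taylor coefficient at [eta] of the divided difference of [f] in
    its first variable, as a function of the second one. *)
Definition mixed (eta : K) k x := \sum_(t < N) tcoef eta k (chi t) * al t x.

Lemma lpoly_mixed eta k : lpoly (mixed eta k).
Proof. by apply: lpoly_sum => t; exact: lpolyZ. Qed.

Let F x w := \sum_(t < N) al t x * chi t w.

Let lF x : lpoly (F x).
Proof. by apply: lpoly_sum => t; apply: lpolyZ; exact: lpoly_chi. Qed.

Let tF eta k x : eta != 0 -> tcoef eta k (F x) = mixed eta k x.
Proof.
move=> e0; rewrite (tcoef_sum _ _ open_punctured) //.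
  by apply: eq_bigr => t _; rewrite mulrC.
by move=> i; apply: smooth_punctured; exact: lpoly_chi.
Qed.

(** Write [w - x] as [(w - eta) + (eta - x)] in
    [f w = f x + (w - x) * F x w] and take Taylor coefficients in [w]. *)
Let fF eta k x : eta != 0 -> x != 0 ->
  tcoef eta k f = tcoef eta k (fun w => (w - eta) * F x w)
   + (eta - x) * mixed eta k x + (k == 0%N)%:R * f x.
Proof.
move=> e0 x0; have oP := @open_punctured K.
have sF := smooth_punctured (lF x).
have s1 : smooth punctured (fun=> f x) by move=> j; exact: cdiff_cst.
have s2 : smooth punctured (fun w => (eta - x) * F x w + f x).
  by apply: smooth_punctured; apply: lpolyD; [exact: lpolyZ|exact: lpoly_cst].
rewrite -(tF k x e0) -(tcoef_cst eta k) -addrA -(tcoef_lin _ _ oP) // -[X in X + _]mul1r.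
rewrite -(tcoef_lin _ _ oP) //; last exact: smooth_subM.
apply: (eq_on_tcoef _ oP) => // w /set_mem w0.
have := fE w0 x0; rewrite (eq_bigr (fun t : 'I_N => al t x * chi t w)); last first.
  by move=> t _; rewrite mulrC.
move/(canRL (subrK _)) => ->; rewrite -/(F x w); ring.
Qed.

Lemma mixed0 eta x : eta != 0 -> x != 0 ->
  (x - eta) * mixed eta 0 x = f x - f eta.
Proof.
move=> e0 x0; have := fF 0 e0 x0.
rewrite tcoef_subM0 add0r eqxx mul1r.
rewrite {1}/tcoef derive1n0 divr1 => ->.
by ring.
Qed.

Lemma mixedS eta k x : eta != 0 -> x != 0 ->
  (x - eta) * mixed eta k.+1 x = mixed eta k x - tcoef eta k.+1 f.
Proof.
move=> e0 x0; rewrite (fF k.+1 e0 x0) (tcoef_subMS _ open_punctured) //; last exact: smooth_punctured.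
by rewrite tF // eqE /= mulr0n mul0r; ring.
Qed.

(** By [mixedS] one order of differentiation can be moved from the first
    variable to the second; at order [0] in the first variable, [mixed0] gives
    a Taylor coefficient of [f] itself. *)
Lemma mixed_diag eta p q : eta != 0 ->
  tcoef eta q (mixed eta p) = tcoef eta (p + q).+1 f.
Proof.
move=> e0; have oP := @open_punctured K.
have aux k c (g : K -> K) : lpoly g -> tcoef eta k.+1 (fun x => g x - c) = tcoef eta k.+1 g.
  move=> lg; transitivity (tcoef eta k.+1 (fun x => 1 * g x + - c)).
    by congr tcoef; apply/funext => x; rewrite mul1r.
  rewrite (tcoef_lin _ _ oP) //; last 2 first.
  - exact: smooth_punctured.
  - by move=> j; exact: cdiff_cst.
  by rewrite tcoef_cst mul0r addr0 mul1r.
elim: p q => [|p IH] q.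
  rewrite add0n -(tcoef_subMS _ oP) //; last exact/smooth_punctured/lpoly_mixed.
  rewrite -(aux q (f eta) f) //; apply: (eq_on_tcoef _ oP) => // x /set_mem.
  exact: mixed0.
rewrite addSnnS -IH -(tcoef_subMS _ oP) //; last exact/smooth_punctured/lpoly_mixed.
rewrite -(aux q (tcoef eta p.+1 f) (mixed eta p)); last exact: lpoly_mixed.
apply: (eq_on_tcoef _ oP) => // x /set_mem; exact: mixedS.
Qed.

(** Near [eta'] one can divide by the powers of [x - eta] in [mixed0] and
    [mixedS]. If [f] vanishes at [eta] to order more than [p], this shows that
    [mixed eta p] is [f] times a smooth function, so that it inherits the zero
    of [f] at [eta']. *)
Lemma mixed_offdiag eta eta' m' p q g : eta != 0 -> eta' != 0 -> eta != eta' ->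
  (forall k, (k <= p)%N -> tcoef eta k f = 0) ->
  (q < m')%N -> lpoly g -> (forall z, z != 0 -> f z = (z - eta') ^+ m' * g z) ->
  tcoef eta' q (mixed eta p) = 0.
Proof.
move=> e0 e0' ne f0 qm lg fg.
(* All Taylor coefficients of f at eta that mixed0 and mixedS subtract vanish. *)
have E k x : (k <= p)%N -> x != 0 -> (x - eta) ^+ k.+1 * mixed eta k x = f x.
  elim: k => [|k IH] kp x0.
    rewrite expr1 mixed0 //; move: (f0 0%N kp).
    by rewrite /tcoef derive1n0 divr1 => ->; rewrite subr0.
  by rewrite exprSr -mulrA mixedS // f0 // subr0 IH // ltnW.
pose U := punctured `&` [set y : K | punctured (y - eta)].
have oU : open U.
  apply: openI; first exact: open_punctured.
  apply: (open_comp (f := fun y : K => y - eta)) open_punctured => y _.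
  by apply: continuousB => //; exact: cst_continuous.
have Ue' : U eta' by split => //=; rewrite /punctured /= subr_eq0 eq_sym.
have sI : smooth U (fun y => (y - eta)^-1).
  move=> j; apply: cdiffV => //; first by move=> y [_]; rewrite /punctured /= => ye.
  by apply: cdiffD => //; [exact: cdiff_id|exact: cdiff_cst].
have sg : smooth U g by apply: smooth_lpoly => // y [].
have sG : smooth U (fun y => g y * (y - eta)^-1 ^+ p.+1).
  by move=> j; apply: cdiffM => //; exact: cdiffX.
transitivity (tcoef eta' q (fun y => (y - eta') ^+ m' * (g y * (y - eta)^-1 ^+ p.+1))).
  apply: (eq_on_tcoef _ oU) => // y /set_mem [y0 ye].
  rewrite mulrA -fg // -(E p y) // mulrAC exprVn mulfV ?mul1r //.
  by rewrite expf_neq0.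
by rewrite (tcoef_expM _ _ oU) // qm.
Qed.

End Mixed.

(** The origin of the matrix [associated_mx]: it collects the conjugates of the
    mixed Taylor coefficients, at pairs of zeros, of the divided difference. *)
Lemma mixed_jets n a d (m : 'I_d -> nat) (eta : 'I_d -> K) (al : nat -> K -> K) s t :
  laurent_zeros n a m eta -> (forall t, lpoly (al t)) ->
  (forall w x, w != 0 -> x != 0 ->
    laurent n a w - laurent n a x = (w - x) * \sum_(t < n.*2) chi t w * al t x) ->
  \sum_(k < n.*2) jet m eta (chi k) 0 s * jet m eta (al k) 0 t
  = (associated_mx m n (a n%:Z) eta s t)^*.
Proof.
move=> aP lal LE; have [inj e0 m0 _ _] := aP; have oP := @open_punctured K.
rewrite associated_mxE.
transitivity (tcoef (eta (tagnat.sig1 t)) (tagnat.sig2 t)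
  (mixed n.*2 al (eta (tagnat.sig1 s)) (tagnat.sig2 s))).
  rewrite (tcoef_sum _ _ oP); [|exact: e0|by move=> i; exact: smooth_punctured].
  by apply: eq_bigr => k _; rewrite !jetE.
have lL := lpoly_laurent n a.
case: eqVneq => [E|ne]; last first.
  rewrite conjC0; apply: (mixed_offdiag LE (e0 _) (e0 _) _ _ (ltn_ord _)
    (lpoly_deflated n m (a n%:Z) eta (tagnat.sig1 t))).
  - by apply: contra_neq ne => /inj.
  - move=> k kp; rewrite (tcoef_laurent aP) (leq_ltn_trans kp) //.
  - by move=> z; exact: laurent_factor.
have <- : eta (tagnat.sig1 s) = eta (tagnat.sig1 t) by rewrite E.
rewrite (mixed_diag lL lal LE) // (tcoef_laurent aP).
have := m0 (tagnat.sig1 s); move: (_ + _)%N => k; case: (m _) => // M _ /=.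
rewrite ltnS [(k < M)%N]ltnNge; case: leqP => kM /=; last by rewrite conjC0.
by rewrite ell_tcoef // conjCK subSS.
Qed.

End MixedJets.

(** * The functional and its Cauchy transforms *)

Section Functional.
Context {K : numClosedFieldType} (u : circle_functional K).
Implicit Types (f g F : K -> K).

Notation rat := (rational_off (supp u)).

Lemma supp_neq0 s : supp u s -> s != 0.
Proof. by move=> /supp_circle s1; rewrite -normr_eq0 s1 oner_eq0. Qed.

Lemma rat_on_supp f : lpoly f -> rat f.
Proof. by apply: rat_lpoly => s; exact: supp_circle. Qed.

Lemma rat_recip_supp f : rat f -> rat (recip_fun f).
Proof. by apply: rat_recip => s; exact: supp_circle. Qed.

Lemma pairing_eq_cofin f g : rat f -> eq_cofin f g -> u f = u g.
Proof. by move=> rf fg; apply: pairing_ext => //; exact: rat_ext fg rf. Qed.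

Lemma pairing0 : u (fun=> 0) = 0.
Proof.
have r0 : rat (fun=> 0) by exact: rat_cst.
have := pairing_linear 1 r0 r0.
have E : (fun=> 1 * 0 + 0 : K) = (fun=> 0 : K) :> (K -> K).
  by apply/funext => z; rewrite mulr0 addr0.
rewrite /= E mul1r.
by move/eqP; rewrite -subr_eq0 opprD addrA subrr sub0r oppr_eq0 => /eqP.
Qed.

Lemma pairing_sum n (c : 'I_n -> K) (F : 'I_n -> K -> K) :
  (forall i, rat (F i)) ->
  u (fun z => \sum_(i < n) c i * F i z) = \sum_(i < n) c i * u (F i).
Proof.
elim: n c F => [|n IH] c F rF.
  rewrite big_ord0 -[RHS]pairing0; congr (pairing u).
  by apply/funext => z; rewrite big_ord0.
rewrite big_ord_recl -IH // -pairing_linear //.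
  by congr (pairing u); apply/funext => z; rewrite big_ord_recl.
by apply: rat_sum => i; apply: ratZ.
Qed.

Lemma pairing_scale c f : rat f -> u (fun w => c * f w) = c * u f.
Proof.
move=> rf; have r0 := rat_cst (supp u) 0.
rewrite -[RHS]addr0 -[X in _ = _ + X]pairing0 -pairing_linear //.
by congr (pairing u); apply/funext => w; rewrite addr0.
Qed.

Lemma rat_pole F y : ~ supp u y -> rat F -> rat (fun w => F w / (w - y)).
Proof.
move=> sy rF; apply: ratM => //.
apply: rat_ext (rat_inv (_ : 'X - y%:P != 0) _).
- by apply: eq_cofin_off0 => z _; rewrite hornerXsubC.
- by rewrite polyXsubC_eq0.
by move=> s ss; rewrite hornerXsubC subr_eq0; apply: contra_notN sy => /eqP <-.
Qed.

Lemma rat_poleX f y k : ~ supp u y -> rat f -> rat (fun w => f w / (w - y) ^+ k).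
Proof.
move=> sy rf; elim: k => [|k IH].
  by apply: rat_ext rf; apply: eq_cofin_off0 => z _; rewrite divr1.
apply: rat_ext (rat_pole sy IH); apply: eq_cofin_off0 => z _.
by rewrite exprSr invfM mulrA.
Qed.

Definition offsupp : set K := punctured `&` ~` supp u.
Definition offsupp_inv : set K := [set z | offsupp z^-1].

Lemma open_offsupp : open offsupp.
Proof.
apply: openI; first exact: open_punctured.
by rewrite openC; exact: supp_closed.
Qed.

Lemma offsupp_inv_neq0 z : offsupp_inv z -> z != 0.
Proof. by move=> []; rewrite /punctured /= invr_eq0. Qed.

Lemma open_offsupp_inv : open offsupp_inv.
Proof.
apply: (@open_comp _ _ (fun z : K => z^-1)) open_offsupp => z /set_mem/offsupp_inv_neq0.
exact: inv_continuous.
Qed.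

(** All orders of the pole are treated together, since the derivative of one
    is a multiple of the next. *)
Lemma smooth_pole F k : rat F -> smooth offsupp (fun x => u (fun w => F w / (w - x) ^+ k.+1)).
Proof.
move=> rF j; elim: j k F rF => // j IH k F rF.
apply: cdiff_step (IH k.+1 (fun w => F w * k.+1%:R) _); first exact: open_offsupp.
  by move=> x [x0 sx]; exact: pairing_derive.
by apply: ratM => //; exact: rat_cst.
Qed.

(** The second slot of the form replaces [(z^* - w)^-1] by its reciprocal
    function, which is [(z - w^-1)^-1]. *)
Definition cauchy F z := u (fun w => F w / (z - w^-1)).

Lemma inv_pole (z w c : K) : z != 0 -> w != 0 ->
  c / (z - w^-1) = z^-1 * (c * w / (w - z^-1)).
Proof.
move=> z0 w0; have -> : z - w^-1 = (w - z^-1) * z / w by field; rewrite w0.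
by rewrite !invfM invrK -!mulrA; ring.
Qed.

Lemma cauchyE F z : rat F -> offsupp_inv z ->
  cauchy F z = z^-1 * u (fun w => F w * w / (w - z^-1) ^+ 1).
Proof.
move=> rF zS; have z0 := offsupp_inv_neq0 zS.
have rw : rat (fun w => w) by apply: rat_on_supp; exact: lpoly_id.
have r1 : rat (fun w => F w * w / (w - z^-1) ^+ 1).
  rewrite (_ : (fun _ => _) = (fun w => F w * w / (w - z^-1))); last first.
    by apply/funext => w; rewrite expr1.
  by apply: rat_pole; [exact: zS.2|exact: ratM].
have r0 : rat (fun=> 0) by exact: rat_cst.
rewrite -[RHS]addr0 -[X in _ = _ + X]pairing0 -pairing_linear //; apply/esym; apply: pairing_eq_cofin.
  by apply: ratD => //; exact: ratZ.
apply: (@eq_cofin_poly _ ('X * ('X - (z^-1)%:P))).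
  by rewrite mulf_neq0 ?polyX_eq0 ?polyXsubC_eq0.
move=> w; rewrite hornerM hornerX hornerXsubC mulf_eq0 negb_or => /andP[w0 _].
by rewrite expr1 addr0 [RHS]inv_pole.
Qed.

Lemma rat_cauchy F z : rat F -> offsupp_inv z -> rat (fun w => F w / (z - w^-1)).
Proof.
move=> rF zS; have z0 := offsupp_inv_neq0 zS.
have rw : rat (fun w => w) by apply: rat_on_supp; exact: lpoly_id.
have r1 : rat (fun w => z^-1 * (F w * w / (w - z^-1))).
  by apply: ratZ; apply: rat_pole; [exact: zS.2|exact: ratM].
apply: rat_ext r1; apply: (@eq_cofin_poly _ ('X * ('X - (z^-1)%:P))).
  by rewrite mulf_neq0 ?polyX_eq0 ?polyXsubC_eq0.
move=> w; rewrite hornerM hornerX hornerXsubC mulf_eq0 negb_or => /andP[w0 _].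
by rewrite [RHS]inv_pole.
Qed.

Lemma smooth_cauchy F : rat F -> smooth offsupp_inv (cauchy F).
Proof.
move=> rF k; have oV := open_offsupp_inv.
have V0 : ~ offsupp_inv 0 by move/offsupp_inv_neq0; rewrite eqxx.
apply: (@eq_on_cdiff _ _ (fun z => z^-1 * u (fun w => F w * w / (w - z^-1) ^+ 1))) => //.
  by move=> z /set_mem zS; rewrite cauchyE.
apply: cdiffM => //; first exact: cdiff_inv.
have rw : rat (fun w => F w * w) by apply: ratM => //; apply: rat_on_supp; exact: lpoly_id.
exact: (cdiff_comp_inv open_offsupp oV V0 _ (@smooth_pole _ 0%N rw k)).
Qed.

(** Used with [h = 1] for the form of [u] and with [h = 1 / L] for the
    part of its Geronimus transform without masses. *)
Lemma weighted_form (h : K -> K) : rat h ->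
  laurent_form (fun f g => u (fun z => f z * recip_fun g z * h z)).
Proof.
move=> rh; split.
- move=> f f' g lf lg ff; apply: pairing_eq_cofin.
    by apply: ratM => //; apply: ratM; [exact: rat_on_supp|apply: rat_on_supp; exact: lpoly_recip].
  by apply: eq_cofin_off0 => z z0; rewrite ff.
- move=> f g g' lf lg gg; apply: pairing_eq_cofin.
    by apply: ratM => //; apply: ratM; [exact: rat_on_supp|apply: rat_on_supp; exact: lpoly_recip].
  by apply: eq_cofin_off0 => z z0; rewrite (eq_off0_recip gg).
- move=> c f f' g lf lf' lg; have lrg := lpoly_recip lg.
  rewrite -pairing_linear; last 2 first.
  + by apply: ratM => //; apply: rat_on_supp; exact: lpolyM.
  + by apply: ratM => //; apply: rat_on_supp; exact: lpolyM.
  by congr (pairing u); apply/funext => z; ring.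
- move=> c f g g' lf lg lg'; have lrg := lpoly_recip lg; have lrg' := lpoly_recip lg'.
  rewrite -pairing_linear; last 2 first.
  + by apply: ratM => //; apply: rat_on_supp; exact: lpolyM.
  + by apply: ratM => //; apply: rat_on_supp; exact: lpolyM.
  by congr (pairing u); apply/funext => z; rewrite recip_lin; ring.
Qed.

Lemma sform_form : laurent_form (sform u).
Proof.
have := weighted_form (rat_cst (supp u) 1); congr laurent_form.
apply/funext => f; apply/funext => g; congr (pairing u).
by apply/funext => z; rewrite mulr1.
Qed.

End Functional.

(** * The Geronimus form *)

Section GeronimusForm.
Context {K : numClosedFieldType} (u : circle_functional K).
Variables (n : nat) (a : int -> K) (d : nat) (m : 'I_d -> nat) (zeta : 'I_d -> K).
Variable Xi : 'M[K]_(\sum_i m i).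
Hypotheses (an_neq0 : a n%:Z != 0) (zetaP : laurent_zeros n a m zeta)
  (sigma_supp : sigma (laurent n a) `&` supp u = set0).
Implicit Types f g : K -> K.

Notation rat := (rational_off (supp u)).
Notation L := (laurent n a).
Notation Ls := (recip_fun L).
Notation uc := (geronimus u n a zeta Xi).
Notation zs := (zeros_star zeta).

Lemma laurent_num : exists2 q : {poly K}, q != 0 &
  forall z, z != 0 -> L z = q.[z] / z ^+ n.
Proof.
have [q sq [qE _]] := laurent_poly n a; exists q => //.
rewrite (laurent_poly_prod zetaP qE) scaler_eq0 negb_or an_neq0 /=.
by apply/prodf_neq0 => i _; rewrite expf_neq0 // polyXsubC_eq0.
Qed.

Lemma rat_laurent_inv : rat (fun z => (L z)^-1).
Proof.
have [q q0 qE] := laurent_num.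
have qS s : supp u s -> q.[s] != 0.
  move=> ss; have s0 := supp_neq0 ss; apply/negP => /eqP qs.
  have : (sigma L `&` supp u) s by split => //; split => //; rewrite qE // qs mul0r.
  by rewrite sigma_supp.
apply: rat_ext (ratM (rat_horner _ 'X^n) (rat_inv q0 qS)).
by apply: eq_cofin_off0 => z z0; rewrite qE // hornerXn invf_div.
Qed.

Lemma laurent_neq0_off : exists2 r : {poly K}, r != 0 &
  forall z, r.[z] != 0 -> z != 0 /\ L z != 0.
Proof.
have [q q0 qE] := laurent_num.
exists ('X * q); first by rewrite mulf_neq0 ?polyX_eq0.
move=> z; rewrite hornerM hornerX mulf_eq0 negb_or => /andP[z0 qz].
by rewrite qE // mulf_neq0 // invr_eq0 expf_neq0.
Qed.

Lemma sum_blocks (F : forall i : 'I_d, 'I_(m i) -> K) :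
  \sum_(i < d) \sum_(k < m i) F i k
  = \sum_(s < \sum_i m i) F (tagnat.sig1 s) (tagnat.sig2 s).
Proof. by rewrite sig_big_dep /= (reindex _ tagnat.sig_bij_on). Qed.

Lemma geronimusE f g : uc f g =
  u (fun z => f z * recip_fun g z * (L z)^-1)
  + (jet m zeta f *m Xi *m adjmx (jet m zs g)) 0 0.
Proof.
congr (_ + _).
pose F i (k : 'I_(m i)) j (r : 'I_(m j)) : K :=
  (k`!%:R * r`!%:R)^-1 * submxblock Xi i j k r *
  derive1n k f (zeta i) * (derive1n r g (zs j))^*.
transitivity (\sum_(i < d) \sum_(k < m i) \sum_(j < d) \sum_(r < m j) F i k j r).
  by apply: eq_bigr => i _; rewrite [LHS]exchange_big.
rewrite (sum_blocks (fun i k => \sum_(j < d) \sum_(r < m j) F i k j r)).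
rewrite -mulmxA mxE; apply: eq_bigr => s _.
rewrite (sum_blocks (F _ _)) [(Xi *m _) _ _]mxE mulr_sumr; apply: eq_bigr => t _.
rewrite /F !mxE !tagnat.sig2K rmorphM fmorphV rmorph_nat invfM; ring.
Qed.

Lemma jet_lin (eta : 'I_d -> K) c f g : (forall i, eta i != 0) -> lpoly f -> lpoly g ->
  jet m eta (fun z => c * f z + g z) = c *: jet m eta f + jet m eta g.
Proof.
move=> e0 lf lg; apply/rowP => s; rewrite [RHS]mxE [in RHS]mxE !jetE.
by rewrite (tcoef_lin _ _ (@open_punctured K)) //; try exact: smooth_punctured; exact: e0.
Qed.

Lemma jet_eq (eta : 'I_d -> K) f g : (forall i, eta i != 0) ->
  (forall z, z != 0 -> f z = g z) -> jet m eta f = jet m eta g.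
Proof.
move=> e0 fg; apply/rowP => s; rewrite !jetE.
by apply: (eq_on_tcoef _ (@open_punctured K)); [exact: e0|move=> z /set_mem /fg].
Qed.

Lemma zeta_neq0 i : zeta i != 0. Proof. by case: zetaP. Qed.
Lemma zs_neq0 i : zs i != 0. Proof. by rewrite invr_eq0 conjC_eq0 zeta_neq0. Qed.

Lemma geronimus_form : laurent_form uc.
Proof.
have [Hl Hr Ll Lr] := weighted_form rat_laurent_inv.
have z0 := zeta_neq0; have zs0 := zs_neq0.
split.
- move=> f f' g lf lg ff; rewrite !geronimusE (Hl _ f') //.
  by rewrite (jet_eq z0 ff).
- move=> f g g' lf lg gg; rewrite !geronimusE (Hr _ _ g') //.
  by rewrite (jet_eq zs0 gg).
- move=> c f f' g lf lf' lg; rewrite !geronimusE Ll // jet_lin //.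
  by rewrite !mulmxDl -!scalemxAl !mxE mulrDr addrACA.
- move=> c f g g' lf lg lg'; rewrite !geronimusE Lr // jet_lin //.
  have -> : adjmx (c *: jet m zs g + jet m zs g')
      = c^* *: adjmx (jet m zs g) + adjmx (jet m zs g').
    by apply/matrixP => i j; rewrite !mxE rmorphD rmorphM.
  by rewrite !mulmxDr -!scalemxAr !mxE mulrDr addrACA.
Qed.

Lemma starP : laurent_zeros n (star_coef a) m zs.
Proof. exact: laurent_zeros_star. Qed.

(** The reciprocal of [Ls] is [L], which cancels the weight, and the jets of
    [Ls g] at the zeros of [Ls] vanish, which cancels the masses. *)
Lemma geronimus_star f g : lpoly f -> lpoly g ->
  uc f (fun z => Ls z * g z) = sform u f g.
Proof.
move=> lf lg; rewrite geronimusE.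
have -> : jet m zs (fun z => Ls z * g z) = 0.
  apply/rowP => s; rewrite jetE mxE; set i := tagnat.sig1 s.
  have oP := @open_punctured K.
  transitivity (tcoef (zs i) (tagnat.sig2 s) (fun z => (z - zs i) ^+ m i *
      (deflated m n (star_coef a n%:Z) zs i z * g z))).
    apply: (eq_on_tcoef _ oP); first exact: zs_neq0.
    move=> z /set_mem z0.
    by rewrite recip_laurent (laurent_factor starP i z0) mulrA.
  rewrite (tcoef_expM _ _ oP) ?ltn_ord //; first exact: zs_neq0.
  by apply: smooth_punctured; apply: lpolyM => //; exact: lpoly_deflated.
have -> : adjmx (0 : 'rV[K]_(\sum_i m i)) = 0.
  by apply/matrixP => i j; rewrite !mxE conjC0.
rewrite mulmx0 mxE addr0; apply: pairing_eq_cofin.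
  apply: ratM rat_laurent_inv; apply: rat_on_supp; apply: lpolyM => //.
  by apply: lpoly_recip; apply: lpolyM => //; apply: lpoly_recip; exact: lpoly_laurent.
have [r r0 rP] := laurent_neq0_off; apply: (eq_cofin_poly r0) => z /rP [z0 Lz].
rewrite recipM recipK; field; exact: Lz.
Qed.

Section RowA.
Variable al : nat -> K -> K.
Hypotheses (lal : forall t, lpoly (al t))
  (LE : forall w x, w != 0 -> x != 0 ->
    Ls w - Ls x = (w - x) * \sum_(t < n.*2) chi t w * al t x).

(** The row [rowA k] as a linear operation on functions: it is the value at
    [phi1 D k]. *)
Definition rowA_of f : 'rV[K]_(\sum_i m i) :=
  jet m (zeros_bar_star zeta) (fun z => sform u f (fun w => (z^* - w)^-1))
  - jet m zeta f *m Xi *m calL_star n a m zeta.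

Lemma sform_cauchy f z : sform u f (fun w => (z^* - w)^-1) = cauchy u f z.
Proof.
congr (pairing u); apply/funext => w; congr (_ * _).
by rewrite /recip_fun /conj_fun fmorphV rmorphB /= !conjCK.
Qed.

Lemma zbs_offsupp i : offsupp_inv u (zeros_bar_star zeta i).
Proof.
have z0 := zeta_neq0 i; rewrite /offsupp_inv /= /zeros_bar_star invrK; split => //.
move=> sz; have : (sigma L `&` supp u) (zeta i).
  split => //; split => //; rewrite (laurent_factor zetaP i z0) subrr expr0n.
  by have [_ _ m0 _ _] := zetaP; rewrite eqn0Ngt m0 mul0r.
by rewrite sigma_supp.
Qed.

Let Fw f w := f w * (L w)^-1.

Let rFw f : lpoly f -> rat (Fw f).
Proof. by move=> lf; apply: ratM rat_laurent_inv; exact: rat_on_supp. Qed.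

Let rFt f t : lpoly f -> rat (fun w => f w * recip_fun (chi t) w * (L w)^-1).
Proof.
move=> lf; apply: ratM rat_laurent_inv; apply: rat_on_supp; apply: lpolyM => //.
by apply: lpoly_recip; exact: lpoly_chi.
Qed.

(** Multiply the kernel [(z - w^-1)^-1] by [L(w) / L(w)] and replace the
    numerator by [L(w) = conj (Ls(conj z)) - (z - w^-1) * Q(w)], where [Q] is the
    reciprocal of the divided difference of [Ls] with second argument
    [conj z]. *)
Lemma cauchy_split f z : lpoly f -> offsupp_inv u z ->
  cauchy u f z = conj_fun Ls z * cauchy u (Fw f) z +
    \sum_(t < n.*2) - u (fun w => f w * recip_fun (chi t) w * (L w)^-1)
       * conj_fun (al t) z.
Proof.
move=> lf zS; have z0 := offsupp_inv_neq0 zS.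
have -> : \sum_(t < n.*2) - u (fun w => f w * recip_fun (chi t) w * (L w)^-1)
       * conj_fun (al t) z = u (fun w => \sum_(t < n.*2) - conj_fun (al t) z *
           (f w * recip_fun (chi t) w * (L w)^-1)).
  rewrite pairing_sum; last by move=> i; exact: rFt.
  by apply: eq_bigr => t _; rewrite mulrC mulrN mulNr.
rewrite /cauchy -pairing_linear; last 2 first.
- by apply: rat_cauchy => //; exact: rFw.
- by apply: rat_sum => t; apply: ratZ; exact: rFt.
apply: pairing_eq_cofin; first by apply: rat_cauchy => //; exact: rat_on_supp.
have [r r0 rP] := laurent_neq0_off.
apply: (@eq_cofin_poly _ (r * ('X - (z^-1)%:P))).
  by rewrite mulf_neq0 ?polyXsubC_eq0.
move=> w; rewrite hornerM hornerXsubC mulf_eq0 negb_or => /andP[/rP [w0 Lw] wz].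
have zw : z - w^-1 != 0.
  apply: contra_neq wz => /eqP; rewrite subr_eq0 => /eqP ->.
  by rewrite invrK subrr.
have wc0 : (w^-1)^* != 0 by rewrite conjC_eq0 invr_eq0.
have zc0 : z^* != 0 by rewrite conjC_eq0.
(* The divided difference at the reflected point of w and at conj z. *)
have := congr1 Num.conj (LE wc0 zc0).
rewrite rmorphB rmorphM rmorphB rmorph_sum /= (conjCK w^-1) (conjCK z).
have -> : (Ls (w^-1)^*)^* = L w.
  by rewrite -[RHS]/(L w) -[L in RHS](recipK L).
set Q := \sum_(i < n.*2) _ => E.
have -> : \sum_(t < n.*2) - conj_fun (al t) z * (f w * recip_fun (chi t) w / L w)
   = - (f w / L w) * Q.
  rewrite /Q mulr_sumr; apply: eq_bigr => t _.
  rewrite rmorphM /= /conj_fun /recip_fun /conj_fun; ring.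
have KE : conj_fun Ls z = L w + (z - w^-1) * Q.
  rewrite /conj_fun -[(Ls z^*)^*](subKr (L w)) E; ring.
rewrite KE /Fw; move: zw; move: (z - w^-1) => y y0; field.
by rewrite Lw y0.
Qed.

(** The Cauchy part contributes the pairings with weight [1 / L] and, by
    [mixed_jets], the part with [calL_star] contributes the masses; together
    they are the values of the Geronimus form. *)
Lemma rowA_of_geronimus f : lpoly f ->
  rowA_of f = - \sum_(t < n.*2) uc f (chi t) *: conj_entries (jet m zs (al t)).
Proof.
move=> lf; apply/rowP => s; have oV := @open_offsupp_inv K u; have oP := @open_punctured K.
have VP : offsupp_inv u `<=` punctured by move=> z; exact: offsupp_inv_neq0.
set i := tagnat.sig1 s; set k := tagnat.sig2 s.
pose v t := u (fun w => f w * recip_fun (chi t) w * (L w)^-1).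
have zi := zbs_offsupp i.
have zE : (zs i)^* = zeros_bar_star zeta i by rewrite /zeros_star fmorphV /= conjCK.
have scal t : smooth punctured (conj_fun (al t)).
  by apply: smooth_punctured; exact: lpoly_conj.
have JC : jet m (zeros_bar_star zeta) (fun z => sform u f (fun w => (z^* - w)^-1)) 0 s
   = - \sum_(t < n.*2) v t * (tcoef (zs i) k (al t))^*.
  rewrite jetE -/i -/k.
  have lD := lpoly_conj (lpoly_deflated n m (star_coef a n%:Z) zs i).
  have sD := smooth_lpoly oV VP lD.
  (* The factor conj_fun Ls has a zero of order m i here, so only the second
     term of cauchy_split contributes to the jet. *)
  have sC : smooth (offsupp_inv u) (cauchy u (Fw f)) by apply: smooth_cauchy; exact: rFw.
  have sDC : smooth (offsupp_inv u) (fun z =>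
     conj_fun (deflated m n (star_coef a n%:Z) zs i) z * cauchy u (Fw f) z).
    by move=> j; exact: cdiffM.
  have sS : smooth (offsupp_inv u) (fun z => \sum_(t < n.*2) - v t * conj_fun (al t) z).
    by apply: smooth_sum => // t j; apply: cdiff_sub VP _; exact: scal.
  transitivity (tcoef (zeros_bar_star zeta i) k (fun z => 1 *
     ((z - zeros_bar_star zeta i) ^+ m i *
        (conj_fun (deflated m n (star_coef a n%:Z) zs i) z * cauchy u (Fw f) z))
      + \sum_(t < n.*2) - v t * conj_fun (al t) z)).
    apply: (eq_on_tcoef _ oV) => // z /set_mem zS.
    rewrite sform_cauchy cauchy_split // mul1r mulrA; congr (_ * _ + _).
    have z0 : z^* != 0 by rewrite conjC_eq0 (offsupp_inv_neq0 zS).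
    rewrite /conj_fun recip_laurent (laurent_factor starP i z0) rmorphM rmorphXn rmorphB.
    by rewrite /= conjCK zE.
  rewrite (tcoef_lin _ _ oV) //; last first.
    move=> j; apply: cdiffM => //; apply: cdiffX => //; apply: cdiffD => //.
      exact: cdiff_id.
    exact: cdiff_cst.
  rewrite (tcoef_expM _ _ oV) // ltn_ord mulr0 add0r.
  rewrite (tcoef_sum _ _ oP) //; last by apply: VP.
  rewrite -sumrN; apply: eq_bigr => t _; rewrite mulNr; congr (- (_ * _)).
  by rewrite (tcoef_conj _ oP) -?zE ?conjCK //; [exact: smooth_punctured | exact: zs_neq0].
rewrite [LHS]mxE JC [X in _ + X]mxE [RHS]mxE summxE -opprD; congr (- _).
rewrite [X in _ + X]mxE.
under [RHS]eq_bigr => t _.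
  rewrite mxE geronimusE -/(v t) mulrDl.
  over.
rewrite big_split /=; congr (_ + _).
  by apply: eq_bigr => t _; rewrite mxE jetE.
set J := jet m zeta f *m Xi.
under [RHS]eq_bigr => t _.
  rewrite mxE mulr_suml.
  over.
rewrite exchange_big /=; apply: eq_bigr => r _.
have LE' : forall w x, w != 0 -> x != 0 -> laurent n (star_coef a) w
   - laurent n (star_coef a) x = (w - x) * \sum_(t < n.*2) chi t w * al t x.
  by rewrite -recip_laurent.
have := mixed_jets r s starP lal LE'.
move=> /(congr1 Num.conj); rewrite conjCK rmorph_sum => H.
rewrite /calL_star -[X in _ * X = _]H mulr_sumr; apply: eq_bigr => t _.
by rewrite rmorphM /= !mxE; ring.
Qed.

End RowA.

End GeronimusForm.

(** * Connection formulas for the first family *)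

Section ConnectionFormulas.
Context {K : numClosedFieldType} (u : circle_functional K).
Variables (n : nat) (a : int -> K) (d : nat) (m : 'I_d -> nat) (zeta : 'I_d -> K).
Variable Xi : 'M[K]_(\sum_i m i).
Hypotheses (n_gt0 : (0 < n)%N) (an_neq0 : a n%:Z != 0) (aNn_neq0 : a (- n%:Z) != 0).
Hypotheses (zetaP : laurent_zeros n a m zeta)
  (sigma_supp : sigma (laurent n a) `&` supp u = set0).
Variables (D Dc : gauss_data K) (l : nat).
Hypotheses (qd_u : quasidefinite (sform u))
  (qd_uc : quasidefinite (geronimus u n a zeta Xi))
  (DP : gauss_factorization (sform u) D)
  (DcP : gauss_factorization (geronimus u n a zeta Xi) Dc)
  (le_2n_l : (n.*2 <= l)%N).
Implicit Types f g : K -> K.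

Notation rat := (rational_off (supp u)).
Notation L := (laurent n a).
Notation Ls := (recip_fun L).
Notation uc := (geronimus u n a zeta Xi).
Notation zs := (zeros_star zeta).
Notation N := (\sum_i m i)%N.
Notation l0 := (l - n.*2)%N.
Notation A := (rowA u n a zeta Xi D).
Notation topA := (\matrix_(i < N) A (l0 + i)%N : 'M[K]_N).
Notation Lm := (a ((-1) ^+ l.+1 * n%:Z)).
Notation H := (gauss_H D).
Notation Af := (rowA_of u n a zeta Xi).

Let uP := sform_form u.
Let ucP := geronimus_form Xi an_neq0 zetaP sigma_supp.

Lemma sum_m : N = n.*2.
Proof. by case: zetaP. Qed.

Lemma l0DN : (l0 + N = l)%N. Proof. by rewrite sum_m subnK. Qed.

Lemma Lm_neq0 : Lm != 0.
Proof. by rewrite -signr_odd; case: (odd l.+1); rewrite ?expr1 ?expr0 ?mul1r ?mulN1r. Qed.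

Lemma span_star k g : cmv_span k g -> cmv_span (k + n.*2) (fun z => Ls z * g z).
Proof.
have [q sq [qE _]] := laurent_poly n (star_coef a) => sg.
by apply: cmv_span_ext (cmv_spanM sq sg) => z z0; rewrite recip_laurent qE.
Qed.

(** The new function of degree [l] enters [Ls phi2] of degree [l - 2 n] with a
    coefficient that depends on the parity of [l] only: a leading or a lowest
    coefficient of [Ls]. *)
Lemma star_phi2 : exists2 h, cmv_span l h &
  forall z, z != 0 -> Ls z * phi2 D l0 z = Lm^* * phi2 Dc l z + h z.
Proof.
have [q sq [qE qc]] := laurent_poly n (star_coef a).
have [f0 sf0 fE] := phi2_monic DP l0.
have [f1 sf1 f1E] := phi2_monic DcP l.
have [g [sg gE]] := cmv_chiM l0 sq.
have l0l : (l0 + n.*2 = l)%N by rewrite subnK.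
rewrite l0l in sg gE.
have cE : (if odd l0 then q`_0%N else q`_n.*2) = Lm^*.
  have -> : odd l0 = odd l by rewrite oddB // odd_double addbF.
  rewrite -signr_odd /= !qc //; case: (odd l) => /=.
    by rewrite /star_coef expr0 mul1r sub0r opprK.
  by rewrite /star_coef expr1 mulN1r; congr ((a _)^*); lia.
rewrite cE in gE.
exists (fun z => 1 * (- Lm^* * f1 z + g z) + Ls z * f0 z).
  apply: cmv_spanD; first exact: cmv_spanD.
  by rewrite -l0l; exact: span_star.
move=> z z0; have := gE z z0; rewrite -qE // -recip_laurent => {}gE.
by rewrite fE f1E mulrDr gE; ring.
Qed.

Lemma sform_star f k : lpoly f -> sform u f (phi2 D k) = uc f (fun z => Ls z * phi2 D k z).
Proof. by move=> lf; rewrite geronimus_star //; exact: lpoly_phi2. Qed.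

Lemma sform_star_l0 f : lpoly f -> exists2 h, cmv_span l h &
  sform u f (phi2 D l0) = Lm * uc f (phi2 Dc l) + uc f h /\
  forall z, z != 0 -> Ls z * phi2 D l0 z = Lm^* * phi2 Dc l z + h z.
Proof.
move=> lf; have [h sh hE] := star_phi2; exists h => //; split => //.
have lLs : lpoly Ls by apply: lpoly_recip; exact: lpoly_laurent.
rewrite sform_star // (form_extr ucP lf _ hE); last first.
  by apply: lpolyM => //; exact: lpoly_phi2.
rewrite form_linr ?conjCK //; first exact: lpoly_phi2.
exact: cmv_span_lpoly sh.
Qed.

Lemma rowA_of_suml M (c : 'I_M -> K) (F : 'I_M -> K -> K) :
  (forall i, lpoly (F i)) ->
  Af (fun z => \sum_(i < M) c i * F i z) = \sum_(i < M) c i *: Af (F i).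
Proof.
move=> lF; have [al lal LE] := has_divdiff_laurent n (star_coef a).
rewrite -recip_laurent in LE.
rewrite (rowA_of_geronimus Xi an_neq0 zetaP sigma_supp lal LE); last first.
  by apply: lpoly_sum => i; exact: lpolyZ.
under [RHS]eq_bigr => i _ do
  rewrite (rowA_of_geronimus Xi an_neq0 zetaP sigma_supp lal LE) // scalerN scaler_sumr.
rewrite sumrN exchange_big /=; congr (- _); apply: eq_bigr => t _.
rewrite form_suml //; last exact: lpoly_chi.
by rewrite scaler_suml; apply: eq_bigr => i _; rewrite scalerA.
Qed.

Lemma rowA_of_ext f g : lpoly f -> (forall z, z != 0 -> f z = g z) -> Af f = Af g.
Proof.
move=> lf fg; have [al lal LE] := has_divdiff_laurent n (star_coef a).
rewrite -recip_laurent in LE; have lg := lpoly_ext fg lf.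
rewrite !(rowA_of_geronimus Xi an_neq0 zetaP sigma_supp lal LE) //.
congr (- _); apply: eq_bigr => t _.
by rewrite (form_extl ucP lf (lpoly_chi t) fg).
Qed.

Lemma sum_tail (V : lmodType K) (c : nat -> K) (F : nat -> V) :
  (forall k, (k < l0)%N -> c k = 0) ->
  \sum_(k < l) c k *: F k = \sum_(i < N) c (l0 + i)%N *: F (l0 + i)%N.
Proof.
move=> c0; suff G M : M = (l0 + N)%N ->
    \sum_(k < M) c k *: F k = \sum_(i < N) c (l0 + i)%N *: F (l0 + i)%N.
  by apply: G; rewrite l0DN.
move=> ->; rewrite big_split_ord /= big1 ?add0r //.
by move=> k _; rewrite c0 ?scale0r.
Qed.

Lemma mul_topA (c : nat -> K) :
  (\row_(i < N) c (l0 + i)%N) *m topA = \sum_(i < N) c (l0 + i)%N *: A (l0 + i)%N.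
Proof.
rewrite mulmx_sum_row; apply: eq_bigr => i _.
by rewrite mxE; congr (_ *: _); apply/rowP => j; rewrite !mxE.
Qed.

Lemma mul_first_col (c : nat -> K) (b : K) :
  ((\row_(i < N) c (l0 + i)%N) *m first_col b) 0 0 = c l0 * b.
Proof.
have N0 : (0 < N)%N by rewrite sum_m double_gt0.
rewrite mxE (bigD1 (Ordinal N0)) //= !mxE /= addn0 big1 ?addr0 //.
by move=> i /negbTE iN; rewrite !mxE ifF ?mulr0.
Qed.

(** The coefficients of [phi1 Dc l] in the functions [phi1 D k]. *)
Let w k := sform u (phi1 Dc l) (phi2 D k) / H k.

Lemma w_low k : (k < l0)%N -> w k = 0.
Proof.
move=> kl; rewrite /w sform_star; last exact: lpoly_phi1.
rewrite (orthogonal_phi1 ucP DcP (span_star (span_phi2 D k))) ?mul0r //.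
by rewrite -ltn_subRL in kl *; lia.
Qed.

Lemma w_l0 : w l0 = Lm * gauss_H Dc l / H l0.
Proof.
have [h sh [hE _]] := sform_star_l0 (lpoly_phi1 Dc l).
rewrite /w hE (biorthogonal ucP DcP) eqxx mul1r.
by rewrite (orthogonal_phi1 ucP DcP sh) // addr0.
Qed.

Lemma w_l : w l = 1.
Proof.
have [f0 sf0 fE] := phi1_monic DP l; have [f1 sf1 f1E] := phi1_monic DcP l.
have l1 := lpoly_phi1 D l; have l2 := lpoly_phi2 D l.
have E z : phi1 Dc l z = 1 * phi1 D l z + (- 1 * f0 z + f1 z).
  by rewrite fE f1E; ring.
have se : cmv_span l (fun z => - 1 * f0 z + f1 z) by exact: cmv_spanD.
rewrite /w (_ : phi1 Dc l = fun z => 1 * phi1 D l z + (- 1 * f0 z + f1 z)); last first.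
  exact/funext.
rewrite form_linl //; last exact: cmv_span_lpoly se.
rewrite (orthogonal_phi2 uP DP se) // addr0 mul1r (biorthogonal uP DP) eqxx mul1r.
by rewrite divff // (gauss_H_neq0 qd_u DP).
Qed.

Lemma phi1c_expand z : z != 0 ->
  phi1 Dc l z = \sum_(i < N) w (l0 + i)%N * phi1 D (l0 + i)%N z + phi1 D l z.
Proof.
move=> z0; rewrite (expand_phi1 uP qd_u DP (span_phi1 Dc l) z0) big_ord_recr /=.
rewrite -/(w l) w_l mul1r; congr (_ + _).
exact: (@sum_tail K^o w (fun k => phi1 D k z) w_low).
Qed.

Lemma rowA_of_phi1c : Af (phi1 Dc l) = 0.
Proof.
have [al lal LE] := has_divdiff_laurent n (star_coef a).
rewrite -recip_laurent in LE.
rewrite (rowA_of_geronimus Xi an_neq0 zetaP sigma_supp lal LE); last exact: lpoly_phi1.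
rewrite [X in - X]big1 ?oppr0 // => t _.
rewrite (orthogonal_phi1 ucP DcP (cmv_span_chi t)) ?scale0r //.
exact: leq_trans (ltn_ord t) le_2n_l.
Qed.

(** Apply the row operation to the expansion of [phi1 Dc l], whose image is
    zero. *)
Lemma w_topA : (\row_(i < N) w (l0 + i)%N) *m topA = - A l.
Proof.
rewrite mul_topA; apply/eqP; rewrite -addr_eq0; apply/eqP.
rewrite -[RHS]rowA_of_phi1c.
have lphi i : lpoly (phi1 D i) := lpoly_phi1 D i.
transitivity (Af (fun z => \sum_(i < l.+1) w i * phi1 D i z)).
  rewrite rowA_of_suml // big_ord_recr /= w_l scale1r; congr (_ + _).
  exact: esym (sum_tail (fun k => Af (phi1 D k)) w_low).
apply: rowA_of_ext.
  by apply: lpoly_sum => i; exact: lpolyZ.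
by move=> z z0; rewrite [RHS](expand_phi1 uP qd_u DP (span_phi1 Dc l) z0).
Qed.

Lemma row_invmx : topA \in unitmx ->
  A l *m invmx topA = - \row_(i < N) w (l0 + i)%N.
Proof. by move=> uA; rewrite -[A l]opprK -w_topA mulNmx mulmxK. Qed.

Lemma phi1c_formula x : topA \in unitmx -> x != 0 ->
  phi1 Dc l x = quasidet topA (\col_(i < N) phi1 D (l0 + i)%N x) (A l) (phi1 D l x).
Proof.
move=> uA x0; rewrite /quasidet row_invmx // mulNmx mxE opprK.
rewrite phi1c_expand // addrC; congr (_ + _).
by rewrite mxE; apply: eq_bigr => i _; rewrite !mxE.
Qed.

Lemma gauss_Hc_formula : topA \in unitmx ->
  gauss_H Dc l = quasidet topA (first_col (H l0 / Lm)) (A l) 0.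
Proof.
move=> uA; rewrite /quasidet row_invmx // mulNmx mxE opprK add0r mul_first_col w_l0.
have Lm0 := Lm_neq0; have H0 := gauss_H_neq0 qd_u DP l0.
by field; rewrite Lm0 H0.
Qed.

Variable z : K.
Hypothesis z0 : z != 0.

Let KD := kernel_sum D (phi2 D) (phi1 D) l z.
Let Kc := kernel_sum Dc (phi2 Dc) (phi1 Dc) l z.
(** The combination of kernels in which all but the last [2 n] of the
    functions [phi1 D k], [k < l], cancel. *)
Let fz x := (Ls z)^* * KD x + - 1 * Kc x.

Let span_kernel E : cmv_span l (kernel_sum E (phi2 E) (phi1 E) l z).
Proof.
suff G k : (k <= l)%N -> cmv_span l (kernel_sum E (phi2 E) (phi1 E) k z) by exact: G.
rewrite /kernel_sum; elim: k => [|k IH] kl.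
  by apply: cmv_spanW (leq0n _) _; apply: cmv_span0 => x _; rewrite big_ord0.
apply: cmv_span_ext (cmv_spanD ((phi2 E k z)^* * (gauss_H E k)^-1)
   (cmv_spanW kl (span_phi1 E k)) (IH (ltnW kl))) => x _.
by rewrite big_ord_recr addrC.
Qed.

Let lKD : lpoly KD. Proof. exact: lpoly_kernel. Qed.
Let lKc : lpoly Kc. Proof. exact: lpoly_kernel. Qed.

Let span_fz : cmv_span l fz.
Proof.
apply: cmv_spanD; first exact: span_kernel.
apply: cmv_span_ext (cmv_spanD (- 1) (span_kernel Dc) (cmv_spanW (leq0n l) (cmv_span0 _))) => [x _|].
  exact: addr0.
by [].
Qed.

(** The coefficients of [fz] in the functions [phi1 D k]. *)
Let v k := sform u fz (phi2 D k) / H k.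

Let sform_fz k : (k < l)%N ->
  sform u fz (phi2 D k) = (Ls z * phi2 D k z)^* - sform u Kc (phi2 D k).
Proof.
move=> kl; have lp := lpoly_phi2 D k.
rewrite form_linl //; last exact: lpolyZ.
rewrite (reproducing uP qd_u DP (cmv_spanW kl (span_phi2 D k))) // rmorphM; congr (_ + _).
have := form_linl uP (- 1) lKc (lpoly_cst 0) lp.
rewrite (form0l uP lp) addr0 mulN1r => <-.
by congr (sform u); apply/funext => x; rewrite addr0.
Qed.

(** For [k + 2 n < l] both kernels reproduce: the old one [phi2 D k], the new
    one [Ls phi2 D k]. *)
Let v_low k : (k < l0)%N -> v k = 0.
Proof.
move=> kl; have kl' : (k < l)%N by lia.
rewrite /v sform_fz // sform_star //.
rewrite (reproducing ucP qd_uc DcP (cmv_spanW _ (span_star (span_phi2 D k)))) //.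
  by rewrite subrr mul0r.
by lia.
Qed.

(** At [k = l - 2 n] the new kernel reproduces all of [Ls phi2 D k] except its
    component along [phi2 Dc l]. *)
Let v_l0 : v l0 = Lm * (phi2 Dc l z)^* / H l0.
Proof.
have l0l : (l0 < l)%N by lia.
have [h sh [hE hz]] := sform_star_l0 lKc.
rewrite /v sform_fz // hE hz // (orthogonal_phi2 ucP DcP (span_kernel Dc)) //.
rewrite mulr0 add0r (reproducing ucP qd_uc DcP sh) //.
by rewrite rmorphD rmorphM /= conjCK addrK.
Qed.

Let rowA_of_fz : Af fz = (\row_(i < N) v (l0 + i)%N) *m topA.
Proof.
have lphi i : lpoly (phi1 D i) := lpoly_phi1 D i.
rewrite mul_topA -(sum_tail A v_low) -rowA_of_suml //.
apply: rowA_of_ext; first exact: cmv_span_lpoly span_fz.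
by move=> x x0; rewrite [LHS](expand_phi1 uP qd_u DP span_fz x0).
Qed.

(** On the diagonal, [mixedS] at [x = eta] identifies the sum with the
    derivative. *)
Lemma divdiff_sum (al : nat -> K -> K) x :
  (forall w x, w != 0 -> x != 0 ->
    Ls w - Ls x = (w - x) * \sum_(t < n.*2) chi t w * al t x) -> x != 0 ->
  divdiff Ls z x = \sum_(t < n.*2) chi t z * al t x.
Proof.
move=> LE x0.
rewrite /divdiff; case: eqVneq => [->|xz]; last first.
  by rewrite LE // mulrC mulKf // subr_eq0 eq_sym.
have := mixedS LE 0 z0 z0.
rewrite subrr mul0r => /esym/eqP; rewrite subr_eq0 => /eqP.
rewrite /tcoef derive1n1 divr1 => <-.
by apply: eq_bigr => t _; rewrite /tcoef derive1n0 divr1.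
Qed.

Let rowA_of_Kc : Af Kc = - conj_entries (jet m zs (divdiff Ls z)).
Proof.
have [al lal LE] := has_divdiff_laurent n (star_coef a).
rewrite -recip_laurent in LE.
rewrite (rowA_of_geronimus Xi an_neq0 zetaP sigma_supp lal LE) //; congr (- _).
have oP := @open_punctured K; have zs0 i := zs_neq0 zetaP i.
apply/rowP => s; rewrite summxE [RHS]mxE jetE.
rewrite (eq_on_tcoef (g := fun x => \sum_(t < n.*2) chi t z * al t x) _ oP); last 2 first.
- exact: zs0.
- by move=> x /set_mem x0; rewrite (divdiff_sum LE x0).
rewrite (tcoef_sum _ _ oP); [|exact: zs0|by move=> i; exact: smooth_punctured].
rewrite rmorph_sum /=; apply: eq_bigr => t _.
rewrite (reproducing ucP qd_uc DcP (cmv_spanW _ (cmv_span_chi t))) //; last first.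
  exact: leq_trans (ltn_ord t) le_2n_l.
by rewrite rmorphM !mxE.
Qed.

Let rowA_of_KD : Af KD = jet m (zeros_bar_star zeta) (CDkernel_phiC u D l z)
   - jet m zeta (CDkernel D l z) *m Xi *m calL_star n a m zeta.
Proof.
congr (_ - _); apply/rowP => s; rewrite !jetE.
apply: (eq_on_tcoef _ (@open_offsupp_inv K u)).
  exact: zbs_offsupp zetaP sigma_supp _.
move=> x /set_mem xS; rewrite sform_cauchy.
transitivity (\sum_(k < l) (phi2 D k z)^* / H k * cauchy u (phi1 D k) x).
  rewrite /cauchy -pairing_sum; last first.
    by move=> k; apply: rat_cauchy => //; apply: rat_on_supp; exact: lpoly_phi1.
  congr (pairing u); apply/funext => y; rewrite /KD /kernel_sum mulr_suml.
  by apply: eq_bigr => k _; rewrite mulrA.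
apply: eq_bigr => k _; congr (_ * _); rewrite /cauchy1 sform_cauchy //.
Qed.

Lemma rowT_topA : rowT u n a zeta Xi D l z = (\row_(i < N) v (l0 + i)%N) *m topA.
Proof.
rewrite -rowA_of_fz /rowT -rowA_of_KD.
have -> : Af fz = (Ls z)^* *: Af KD - Af Kc.
  have lF : forall i : 'I_2, lpoly (if i == 0 then KD else Kc) by move=> i; case: ifP.
  have := @rowA_of_suml 2 (fun i => if i == 0 then (Ls z)^* else - 1)
    (fun i => if i == 0 then KD else Kc) lF.
  rewrite !big_ord_recr big_ord0 /= add0r scaleN1r => <-.
  by congr Af; apply/funext => x; rewrite !big_ord_recr big_ord0 /= add0r.
by rewrite rowA_of_Kc opprK.
Qed.

Lemma phi2c_formula : topA \in unitmx ->
  (phi2 Dc l z)^* = - quasidet topA (first_col (H l0 / Lm)) (rowT u n a zeta Xi D l z) 0.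
Proof.
move=> uA; rewrite /quasidet rowT_topA mulmxK // mul_first_col v_l0 sub0r opprK.
have Lm0 := Lm_neq0; have H0 := gauss_H_neq0 qd_u DP l0.
by field; rewrite Lm0 H0.
Qed.

End ConnectionFormulas.

(** * The dual functional *)

Section DualFunctional.
Context {K : numClosedFieldType} (u : circle_functional K).
Implicit Types f g : K -> K.

Notation rat := (rational_off (supp u)).

Definition dual_pairing f : K := (u (recip_fun f))^*.

Lemma dual_ext f g : rat f -> rat g -> finite_set [set z | f z != g z] ->
  dual_pairing f = dual_pairing g.
Proof.
move=> rf rg fg; congr (_^*); apply: pairing_eq_cofin; first exact: rat_recip_supp.
exact: eq_cofin_recip.
Qed.

Lemma dual_linear c f g : rat f -> rat g ->
  dual_pairing (fun w => c * f w + g w) = c * dual_pairing f + dual_pairing g.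
Proof.
move=> rf rg; rewrite /dual_pairing recip_lin pairing_linear; try exact: rat_recip_supp.
by rewrite rmorphD rmorphM /= conjCK.
Qed.

Lemma recip_offsupp x : offsupp u x -> offsupp u (x^-1)^*.
Proof.
move=> [x0 sx]; split; first by rewrite /punctured /= conjC_eq0 invr_eq0.
move=> sy; apply: sx; have := circle_recip (supp_circle sy).
by rewrite fmorphV /= conjCK invrK => ->.
Qed.

Let num f k w := recip_fun f w * w ^+ k.+1.

Let rat_num f k : rat f -> rat (num f k).
Proof.
move=> rf; apply: ratM; first exact: rat_recip_supp.
by apply: rat_on_supp; apply: lpolyX; exact: lpoly_id.
Qed.

(** The pole at [x] is reflected in the unit circle, which produces the factor
    [w ^ (k + 1)] in the numerator. *)
Lemma dual_pole f k x : rat f -> offsupp u x ->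
  dual_pairing (fun w => f w / (w - x) ^+ k.+1)
  = (- x^-1) ^+ k.+1 * (u (fun w => num f k w / (w - (x^-1)^*) ^+ k.+1))^*.
Proof.
move=> rf xS; have [x0 sx] := xS; have [y0 sy] := recip_offsupp xS.
have cx0 : x^* != 0 by rewrite conjC_eq0.
rewrite /dual_pairing -[(- x^-1) ^+ _]conjCK -rmorphM; congr (_^*).
rewrite -[RHS]addr0 -[X in _ = _ + X](pairing0 u) -pairing_linear; last 2 first.
- by apply: rat_poleX => //; exact: rat_num.
- exact: rat_cst.
apply/esym; apply: pairing_eq_cofin.
  apply: ratD; last exact: rat_cst.
  by apply: ratZ; apply: rat_poleX => //; exact: rat_num.
apply: eq_cofin_off0 => w w0.
have -> : recip_fun (fun w => f w / (w - x) ^+ k.+1) w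
    = recip_fun f w * (w^-1 - x^*)^-1 ^+ k.+1.
  rewrite recipM; congr (_ * _); rewrite /recip_fun /conj_fun exprVn.
  by rewrite fmorphV rmorphXn rmorphB /= conjCK.
rewrite addr0 /num rmorphXn rmorphN fmorphV /= -exprVn.
rewrite -!mulrA mulrCA -!exprMn; congr (_ * _ ^+ _).
have -> : w^-1 - x^* = - x^* * (w - x^*^-1) / w by field; rewrite cx0 w0.
have -> : (x^-1)^* = x^*^-1 by exact: fmorphV.
by rewrite !invfM invrK invrN; ring.
Qed.

(** By [dual_pole] the function to be differentiated is, up to a sign, the value
    at [x^-1] of [z ^ (k + 1)] times a conjugated pole transform, so that the
    derivative follows from the product and chain rules. Splitting
    [w = (w - y) + y] in the numerator of the expected derivative gives the
    same two terms. *)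
Lemma dual_derive f (b : K) (k : nat) : rat f -> b != 0 -> ~ supp u b ->
  is_derive b (1 : K)
      (fun x : K => dual_pairing (fun w => f w / (w - x) ^+ k.+1) : K)
      (dual_pairing (fun w => f w * k.+1%:R / (w - b) ^+ k.+2)).
Proof.
move=> rf b0 sb; have bS : offsupp u b by [].
have := recip_offsupp bS; move yE: (b^-1)^* => y [y0 sy].
pose Phi x := u (fun w => num f k w / (w - x) ^+ k.+1).
pose Phi' := u (fun w => num f k w * k.+1%:R / (w - y) ^+ k.+2).
have dPhi : is_derive y (1 : K) Phi Phi' by apply: pairing_derive => //; exact: rat_num.
have dc : is_derive b^-1 (1 : K) (conj_fun Phi) Phi'^*.
  by apply: is_derive_conj_fun; rewrite yE.
have dM := is_deriveM (is_derive_exp b^-1 k.+1) dc.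
have dcomp := is_derive_comp (is_derive_inv b0) dM.
have dZ := is_deriveZ ((- 1) ^+ k.+1) dcomp.
have oS := @open_offsupp K u.
have E : {in offsupp u, (-1) ^+ k.+1 \*: (((fun z : K => z ^+ k.+1) * conj_fun Phi) \o (fun z => z^-1))
    =1 fun x => dual_pairing (fun w => f w / (w - x) ^+ k.+1)}.
  move=> x /set_mem xS; rewrite dual_pole //.
  by rewrite -[- x^-1]mulN1r exprMn -[RHS]mulrA.
apply: is_derive_eq (eq_on_is_derive oS bS E dZ) _.
have rf' : rat (fun w => f w * k.+1%:R) by apply: ratM => //; exact: rat_cst.
rewrite dual_pole // yE.
have r1 : rat (fun w => num f k w / (w - y) ^+ k.+1).
  by apply: rat_poleX => //; exact: rat_num.
have r2 : rat (fun w => num f k w * k.+1%:R / (w - y) ^+ k.+2).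
  by apply: rat_poleX => //; apply: ratM; [exact: rat_num|exact: rat_cst].
have -> : u (fun w => num (fun w => f w * k.+1%:R) k.+1 w / (w - y) ^+ k.+2)
    = k.+1%:R * Phi y + y * Phi'.
  rewrite -(pairing_scale y r2) -pairing_linear //; last exact: ratZ.
  apply: pairing_eq_cofin; first by apply: rat_poleX => //; exact: rat_num.
  apply: (@eq_cofin_poly _ ('X - y%:P)); first by rewrite polyXsubC_eq0.
  move=> w; rewrite hornerXsubC => wy.
  rewrite /num recipM (_ : recip_fun (fun=> k.+1%:R) w = k.+1%:R); last first.
    by rewrite /recip_fun /conj_fun rmorph_nat.
  move: (recip_fun f w) => F; rewrite !exprS; field.
  by rewrite wy expf_neq0.
have -> : conj_fun Phi b^-1 = (Phi y)^* by rewrite -yE.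
have yc : y^* = b^-1 by rewrite -yE conjCK.
rewrite rmorphD !rmorphM rmorph_nat /= yc -[- b^-1 in RHS]mulN1r exprMn.
(* s stands for b^-1, e and t for the k-th powers of -1 and s. *)
have alg (e s t P Q c : K) : (- 1 * e) * ((s * t * P + Q * (c * t)) * (- s ^+ 2))
    = (- 1 * (- 1 * e)) * (s * (s * t)) * (c * Q + s * P) by ring.
rewrite (exprS _ k.+1) (exprS _ k) (exprS b^-1 k.+1) (exprS b^-1 k).
exact: alg.
Qed.

End DualFunctional.

(** * Exchanging the two families *)

Section Duality.
Context {K : numClosedFieldType} (u : circle_functional K).
Implicit Types f g : K -> K.

Definition dual_functional : circle_functional K :=
  CircleFunctional (@supp_closed K u) (@supp_circle K u) (@dual_ext K u)
    (@dual_linear K u) (@dual_derive K u).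

Lemma sform_dual f g : sform dual_functional f g = (sform u g f)^*.
Proof.
congr (_^*); congr (pairing u); apply/funext => z.
by rewrite recipM recipK mulrC.
Qed.

Definition dual_gauss (D : gauss_data K) : gauss_data K :=
  GaussData (gauss_S2 D) (gauss_S1 D) (fun k => (gauss_H D k)^*).

Lemma truncmx_gram_dual (B : (K -> K) -> (K -> K) -> K) N :
  truncmx N (gram (fun f g => (B g f)^*)) = adjmx (truncmx N (gram B)).
Proof. by apply/matrixP => i j; rewrite !mxE. Qed.

Lemma gauss_dual B D : gauss_factorization B D ->
  gauss_factorization (fun f g => (B g f)^*) (dual_gauss D).
Proof.
move=> [L1 L2 GE]; split => // N; rewrite truncmx_gram_dual GE !adjmxM adjmxK mulmxA.
congr (_ *m _ *m _); apply/matrixP => i j; rewrite !mxE rmorphMn /= eq_sym.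
by case: eqVneq => [->|].
Qed.

Lemma quasidefinite_dual (B : (K -> K) -> (K -> K) -> K) :
  quasidefinite B -> quasidefinite (fun f g => (B g f)^*).
Proof.
move=> qB N; rewrite truncmx_gram_dual /adjmx det_tr /conj_entries det_map_mx.
by rewrite conjC_eq0 qB.
Qed.

Lemma zeros_starK d (zeta : 'I_d -> K) : zeros_star (zeros_star zeta) = zeta.
Proof. by apply/funext => i; rewrite /zeros_star fmorphV /= conjCK invrK. Qed.

Lemma zeros_bar_star_star d (zeta : 'I_d -> K) :
  zeros_bar_star (zeros_star zeta) = zeros_bar zeta.
Proof. by apply/funext => i; rewrite /zeros_bar_star invrK. Qed.

Lemma star_coefK (a : int -> K) : star_coef (star_coef a) = a.
Proof. by apply/funext => i; rewrite /star_coef conjCK opprK. Qed.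

Section Data.
Variables (n : nat) (a : int -> K) (d : nat) (m : 'I_d -> nat) (zeta : 'I_d -> K).
Variable Xi : 'M[K]_(\sum_i m i).
Notation L := (laurent n a).
Notation zs := (zeros_star zeta).
Notation a' := (star_coef a).

Lemma recip_laurent_star : recip_fun (laurent n a') = L.
Proof. by rewrite recip_laurent star_coefK. Qed.

(** The dual weight is [1 / Ls], whose reciprocal is [1 / L]; in the masses the
    roles of the points [zeta i] and [zeros_star zeta j] are exchanged. *)
Lemma geronimus_dual : geronimus dual_functional n a' zs (adjmx Xi)
  = fun f g => (geronimus u n a zeta Xi g f)^*.
Proof.
apply/funext => f; apply/funext => g; rewrite /geronimus rmorphD; congr (_ + _).
  congr (_^*); congr (pairing u); apply/funext => z.
  rewrite recipM recipM recipK [_ * g z]mulrC; congr (_ * _).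
  by rewrite -[in RHS]recip_laurent_star /recip_fun /conj_fun fmorphV.
rewrite zeros_starK rmorph_sum /= [LHS]exchange_big /=; apply: eq_bigr => i _.
rewrite rmorph_sum /=; apply: eq_bigr => j _.
rewrite rmorph_sum /= [LHS]exchange_big /=; apply: eq_bigr => k _.
rewrite rmorph_sum /=; apply: eq_bigr => r _.
rewrite !rmorphM fmorphV rmorphM !rmorph_nat !mxE /= conjCK !invfM; ring.
Qed.

Lemma sigma_dual : sigma L `&` supp u = set0 ->
  sigma (laurent n a') `&` supp dual_functional = set0.
Proof.
move=> H; apply/seteqP; split => // z [[z0 Lz] sz].
suff : (sigma L `&` supp u) z by rewrite H.
split => //; split => //; rewrite -recip_laurent_star /recip_fun /conj_fun.
by rewrite (circle_recip (supp_circle sz)) Lz conjC0.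
Qed.

Variable D : gauss_data K.

Lemma calL_star_dual : calL_star n a' m zs = calL n a m zeta.
Proof. by rewrite /calL_star /calL zeros_starK /star_coef opprK conjCK. Qed.

Lemma cauchy1_dual k : cauchy1 dual_functional (dual_gauss D) k = cauchy2 u D k.
Proof. by apply/funext => z; rewrite /cauchy1 sform_dual. Qed.

Lemma rowA_dual k : rowA dual_functional n a' zs (adjmx Xi) (dual_gauss D) k
  = rowB u n a zeta Xi D k.
Proof. by rewrite /rowA /rowB zeros_bar_star_star cauchy1_dual calL_star_dual. Qed.

Lemma conj_entriesD p q (M M' : 'M[K]_(p, q)) :
  conj_entries (M + M') = conj_entries M + conj_entries M'.
Proof. exact: map_mxD. Qed.

Lemma conj_entriesK p q (M : 'M[K]_(p, q)) : conj_entries (conj_entries M) = M.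
Proof. by apply/matrixP => i j; rewrite !mxE conjCK. Qed.

Lemma rowT_dual l z :
  conj_entries (rowT dual_functional n a' zs (adjmx Xi) (dual_gauss D) l z)
  = rowR u n a zeta Xi D l z.
Proof.
have kernelE (F G : nat -> K -> K) :
    kernel_sum (dual_gauss D) F G l z = fun x => (kernel_sum D G F l x z)^*.
  apply/funext => x; rewrite rmorph_sum; apply: eq_bigr => k _.
  rewrite !rmorphM /= conjCK fmorphV /=; ring.
rewrite /rowT /rowR /CDkernel_phiC /CDkernel !kernelE recip_laurent_star.
rewrite zeros_bar_star_star zeros_starK calL_star_dual conj_entriesD conj_entriesK.
have -> : cauchy1 dual_functional (dual_gauss D) = cauchy2 u D.
  by apply/funext => k; exact: cauchy1_dual.
congr (_ + _); rewrite /conj_entries map_mxZ /= conjCK map_mxB.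
by [].
Qed.

End Data.

Lemma quasidet_conj N (M : 'M[K]_N) (B : 'cV[K]_N) (C : 'rV[K]_N) (x : K) :
  (quasidet M B C x)^*
  = quasidet (conj_entries M) (conj_entries B) (conj_entries C) x^*.
Proof.
rewrite /quasidet rmorphB /conj_entries -map_invmx -!map_mxM; congr (_ - _).
by rewrite [RHS]mxE.
Qed.

End Duality.

Theorem theorem3 (R : realType) (u : circle_functional R[i])
    (n d : nat) (a : int -> R[i]) (m : 'I_d -> nat) (zeta : 'I_d -> R[i])
    (Xi : 'M[R[i]]_(\sum_i m i)) (D Dc : gauss_data R[i]) (l : nat)
    (n_gt0 : (0 < n)%N) (an_neq0 : a n%:Z != 0) (aNn_neq0 : a (- n%:Z) != 0)
    (zetaP : laurent_zeros n a m zeta)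
    (sigma_supp : sigma (laurent n a) `&` supp u = set0)
    (qd_u : quasidefinite (sform u))
    (qd_uc : quasidefinite (geronimus u n a zeta Xi))
    (DP : gauss_factorization (sform u) D)
    (DcP : gauss_factorization (geronimus u n a zeta Xi) Dc)
    (le_2n_l : (n.*2 <= l)%N) :
  let N := (\sum_i m i)%N in
  let l0 := (l - n.*2)%N in
  let A := rowA u n a zeta Xi D in
  let B := rowB u n a zeta Xi D in
  let topA : 'M[R[i]]_N := \matrix_(i < N) A (l0 + i)%N in
  let topB : 'M[R[i]]_N := \matrix_(i < N) B (l0 + i)%N in
  let colphi1 z : 'cV[R[i]]_N := \col_(i < N) phi1 D (l0 + i)%N z in
  let colphi2 z : 'cV[R[i]]_N := \col_(i < N) phi2 D (l0 + i)%N z in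
  let H := gauss_H D in
  let Lp := a ((-1) ^+ l * n%:Z) in
  let Lm := a ((-1) ^+ l.+1 * n%:Z) in
  (topA \in unitmx ->
    [/\ (forall z, z != 0 ->
           phi1 Dc l z = quasidet topA (colphi1 z) (A l) (phi1 D l z)),
        gauss_H Dc l = quasidet topA (first_col (H l0 / Lm)) (A l) 0 &
        forall z, z != 0 ->
           (phi2 Dc l z)^* =
           - quasidet topA (first_col (H l0 / Lm))
                      (rowT u n a zeta Xi D l z) 0])
  /\
  (topB \in unitmx ->
    [/\ (forall z, z != 0 ->
           phi1 Dc l z =
           - quasidet (conj_entries topB) (first_col (H l0 / Lp))
                      (rowR u n a zeta Xi D l z) 0),
        gauss_H Dc l =
          (quasidet topB (first_col ((H l0)^* / Lp^*)) (B l) 0)^* &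
        forall z, z != 0 ->
           (phi2 Dc l z)^* =
           (quasidet topB (colphi2 z) (B l) (phi2 D l z))^*]).
Proof.
move=> N l0 A B topA topB colphi1 colphi2 H Lp Lm; split => [uA|uB].
  split.
  - by move=> z z0; apply: (phi1c_formula n_gt0 an_neq0 aNn_neq0 zetaP sigma_supp qd_u DP DcP).
  - exact: (gauss_Hc_formula n_gt0 an_neq0 aNn_neq0 zetaP sigma_supp qd_u DP DcP).
  - by move=> z z0; apply: (phi2c_formula n_gt0 an_neq0 aNn_neq0 zetaP sigma_supp qd_u qd_uc DP DcP).
have sE : sform (dual_functional u) = fun f g => (sform u g f)^*.
  by apply/funext => f; apply/funext => g; exact: sform_dual.
have an' : star_coef a n%:Z != 0 by rewrite /star_coef conjC_eq0.
have aNn' : star_coef a (- n%:Z) != 0 by rewrite /star_coef opprK conjC_eq0.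
have zP' := laurent_zeros_star zetaP.
have sg' := sigma_dual sigma_supp.
have qu' := quasidefinite_dual qd_u; rewrite -sE in qu'.
have quc' := quasidefinite_dual qd_uc; rewrite -geronimus_dual in quc'.
have DP' := gauss_dual DP; rewrite -sE in DP'.
have DcP' := gauss_dual DcP; rewrite -geronimus_dual in DcP'.
have AE : rowA (dual_functional u) n (star_coef a) (zeros_star zeta) (adjmx Xi)
    (dual_gauss D) = B by apply/funext => k; exact: rowA_dual.
have LpE : star_coef a ((-1) ^+ l.+1 * n%:Z) = Lp^*.
  by rewrite /star_coef exprS mulN1r mulNr opprK.
have first_colJ (c : R[i]) : conj_entries (first_col c : 'cV[_]_N) = first_col c^*.
  by apply/matrixP => i j; rewrite !mxE; case: ifP => _; rewrite ?conjC0.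
have h1 z := @phi1c_formula _ _ _ _ _ _ _ _ n_gt0 an' aNn' zP' sg' _ _ _ qu' DP' DcP'
  le_2n_l z.
have h2 := gauss_Hc_formula n_gt0 an' aNn' zP' sg' qu' DP' DcP' le_2n_l.
have h3 z := @phi2c_formula _ _ _ _ _ _ _ _ n_gt0 an' aNn' zP' sg' _ _ _ qu' quc' DP' DcP'
  le_2n_l z.
rewrite AE LpE in h1 h2 h3.
split.
- move=> z z0; have E : (phi1 Dc l z)^* = _ := h3 z z0 uB.
  have HE : (gauss_H (dual_gauss D) (l - n.*2)%N / Lp^*)^* = H l0 / Lp.
    by rewrite rmorphM fmorphV /= !conjCK.
  apply: etrans (esym (conjCK _)) _; rewrite E rmorphN.
  apply: etrans (congr1 -%R (quasidet_conj _ _ _ _)) _.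
  by rewrite rowT_dual first_colJ conjC0 HE.
- by rewrite -[LHS]conjCK; congr (_^*); exact: h2.
- by move=> z z0; congr (_^*); exact: h1.
Qed.
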